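(* Let $D\subset\mathbb{C}^n$ be a bounded domain (not necessarily pseudoconvex) with smooth ($C^\infty$) boundary $S=\partial D$, and let $1\le q\le n-1$ be an integer. Assume that for every $p\in S$ the tower multitype $\mathcal{T}(p)=(t_1,\ldots,t_{n-1})$ of $S$ at $p$ satisfies $\#\{k:t_k=\infty\}<q$. Then $S=\partial D$ is countably $q$-regular. In fact, the sets $S_k$ in the definition of countable $q$-regularity can be chosen to be the level sets of the tower multitype function $\mathcal{T}$.
   Context: Let $S\subset\mathbb{C}^n$, $n\ge2$, be a smooth real hypersurface. $HS$ is its complex tangent bundle, $\mathbb{C}HS=H^{10}S\oplus\overline{H^{10}S}$ the complexification, $H^{10}S$ the bundle of $(1,0)$ tangent vectors. A complex contact form $\theta$ (defined locally) is a nowhere zero $\mathbb{C}$-valued $1$-form on $S$ vanishing on $\mathbb{C}HS$. For a list $L^t,\ldots,L^1\in\Gamma(H^{10}S)\cup\Gamma(\overline{H^{10}S})$ of local vector fields, $t\ge1$, the $\theta$-dual form is the complex $1$-form on $H^{10}S$ defined, for $L\in\Gamma(H^{10}S)$, by $\omega_{L^1;\theta}(L_p)=\theta([L,L^1])(p)$ if $t=1$, and $\omega_{L^t,\ldots,L^1;\theta}(L_p)=(Lf)(p)$ with $f=\mathrm{Re}\,(L^t\cdots L^3\,\theta([L^2,L^1]))$ if $t\ge2$. For a complex subbundle $E\subset H^{10}S$, a form is $E$-dual of order $t\in\mathbb{N}_{\ge2}$ if it is the $\theta$-dual form of a list of $t-1$ vector fields in $\Gamma(E)\cup\Gamma(\overline{E})$.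 A tower of multi-order $(t_1,\ldots,t_{n-1})\in(\mathbb{N}_{\ge2}\cup\{\infty\})^{n-1}$ is a nested sequence of complex subbundles $H^{10}S=E_0\supset\cdots\supset E_m$, $0\le m\le n-1$, such that $t_{m+1}=\cdots=t_{n-1}=\infty$ and for $k=1,\ldots,m$ one has $t_k\in\mathbb{N}_{\ge2}$ and there is an $E_{k-1}$-dual form $\omega_k$ of order $t_k$ not vanishing on (each fiber of) $E_{k-1}$ with $E_k=E_{k-1}\cap\{\omega_k=0\}$. The tower multitype $\mathcal{T}(p)$ is the lexicographically minimum multi-order of a tower on a neighborhood of $p$ in $S$; it is independent of $\theta$. A CR submanifold $M\subset S$ is a smooth real submanifold such that $H^{10}_xM:=\mathbb{C}T_xM\cap H^{10}_xS$ has constant dimension for $x\in M$. $K^{10}_x\subset H^{10}_xS$ is the kernel of the Levi form of $S$ at $x$. $S$ is countably $q$-regular if it is a countable disjoint union $S=\bigcup_kS_k$ of locally closed subsets $S_k\subset S$ such that for each $k$ and $p\in S_k$ there exists a CR submanifold $M\subset S$ such that: (1) $M$ contains an open neighborhood of $p$ in $S_k$ (relative topology); (2) $\dim_{\mathbb{C}}(H^{10}_xM\cap K^{10}_x)<q$ for all $x\in M$. *)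

(* Defs.v *)
From mathcomp Require Import all_boot all_order all_algebra.
From mathcomp Require Import complex.
From mathcomp Require Import all_classical all_reals all_analysis.

Set Implicit Arguments.
Unset Strict Implicit.
Unset Printing Implicit Defensive.

Import Order.TTheory GRing.Theory Num.Theory.
Import numFieldNormedType.Exports.

Local Open Scope classical_set_scope.
Local Open Scope ring_scope.
Local Open Scope complex_scope.

(* C^n is identified with R^(n + n) by z = x + i y |-> row_mx x y.
   [cvec R n] is the complexification of the tangent space of C^n at a point,
   in the basis d/dx_1, .., d/dx_n, d/dy_1, .., d/dy_n. *)
Notation pt R n := 'rV[R]_(n + n).
Notation cvec R n := 'rV[R[i]]_(n + n).

Section Smooth.
Context {R : realType} {V W : normedModType R}.

Fixpoint Ck_on (k : nat) (U : set V) (f : V -> W) : Prop :=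
  if k is k'.+1 then
    (forall x, U x -> differentiable f x) /\
    (forall v, Ck_on k' U (fun x => 'D_v f x))
  else forall x, U x -> {for x, continuous f}.

Definition smooth_on (U : set V) (f : V -> W) : Prop := forall k, Ck_on k U f.

End Smooth.

Section TowerMultitype.
Context {R : realType} {n : nat}.
Local Notation V := (pt R n).
Local Notation CV := (cvec R n).
Local Notation C := (R[i]).
(* vector fields; also complex 1-forms, given by their coefficients with
   respect to dx_1, .., dx_n, dy_1, .., dy_n *)
Local Notation field := (V -> CV).

Definition csmooth_on (U : set V) (f : V -> C) : Prop :=
  smooth_on U (fun x => complex.Re (f x)) /\
  smooth_on U (fun x => complex.Im (f x)).

Definition smooth_field_on (U : set V) (X : field) : Prop :=
  forall j, csmooth_on U (fun x => X x ord0 j).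

Definition cderive (f : V -> C) (x : V) (v : CV) : C :=
  \sum_j v ord0 j *
    ('D_(delta_mx ord0 j) (fun y => complex.Re (f y)) x +i*
     'D_(delta_mx ord0 j) (fun y => complex.Im (f y)) x).

Definition lie_derive (X : field) (f : V -> C) : V -> C :=
  fun x => cderive f x (X x).

Definition bracket (X Y : field) : field := fun x =>
  \row_j (lie_derive X (fun y => Y y ord0 j) x -
          lie_derive Y (fun y => X y ord0 j) x).

Definition pairing (w v : CV) : C := \sum_j w ord0 j * v ord0 j.

Definition form_app (theta X : field) : V -> C :=
  fun x => pairing (theta x) (X x).

Definition conjv (v : CV) : CV := map_mx conjc v.

Definition conjf (X : field) : field := fun x => conjv (X x).

Definition has_dim (A : set CV) (d : nat) : Prop :=
  exists E : {vspace CV}, A = [set v | v \in E] /\ \dim E = d.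

Definition submanifold (M : set V) : Prop :=
  exists c : nat, forall x, M x ->
    exists (U : set V) (F : V -> 'rV[R]_c),
      [/\ open U, U x, smooth_on U F,
          (forall y, U y -> M y -> forall w, exists v, 'D_v F y = w) &
          M `&` U = U `&` [set y | F y = 0]].

(* C (x) T_x M for an embedded submanifold M of R^(n + n): the vectors
   killing all smooth functions near x that vanish on M. *)
Definition CT (M : set V) (x : V) : set CV := [set v |
  forall (U : set V) (g : V -> R), open U -> U x -> smooth_on U g ->
    (forall y, M y -> U y -> g y = 0) -> cderive (fun y => (g y)%:C) x v = 0].

(* type (1, 0): v annihilates every d(bar z_j) = dx_j - i dy_j *)
Definition type10 : set CV := [set v | lsubmx v = 'i%C *: rsubmx v].

Definition H10 (S : set V) (x : V) : set CV := CT S x `&` type10.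

Definition CH (S : set V) (x : V) : set CV :=
  [set v | exists a b, [/\ H10 S x a, H10 S x b & v = a + conjv b]].

(* Local sections over S `&` U of a family E of subspaces of the
   complexified tangent spaces are represented by smooth extensions to the
   open set U of R^(n + n): Lie derivatives of functions on S along tangent
   fields and brackets of tangent fields do not depend, along S, on the
   extensions chosen. *)
Definition section (S U : set V) (E : V -> set CV) (X : field) : Prop :=
  smooth_field_on U X /\ forall x, U x -> S x -> E x (X x).

Definition conj_section (S U : set V) (E : V -> set CV) (X : field) : Prop :=
  section S U E (conjf X).

Definition subbundle (S U : set V) (r : nat) (E : V -> set CV) : Prop :=
  (forall x, U x -> S x -> E x `<=` H10 S x) /\
  (forall x, U x -> S x -> exists (U' : set V) (X : 'I_r -> field),
    [/\ open U', U' x, U' `<=` U, forall i, smooth_field_on U' (X i) &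
        forall y, U' y -> S y ->
          free [tuple X i y | i < r] /\
          E y = [set v | v \in <<[tuple X i y | i < r]>>%VS]]).

Definition contact_form (S U : set V) (theta : field) : Prop :=
  [/\ smooth_field_on U theta,
      (forall x v, U x -> S x -> CH S x v -> pairing (theta x) v = 0) &
      forall x, U x -> S x -> exists v, CT S x v /\ pairing (theta x) v != 0].

(* Lists L^t, .., L^1 are stored in increasing order [:: L^1; L^2; ..; L^t]. *)
Definition dual_form_on (theta : field) (l : seq field) (L : field) : V -> C :=
  match l with
  | [::] => fun=> 0
  | [:: L1] => form_app theta (bracket L L1)
  | [:: L1, L2 & l'] =>
      lie_derive L (fun x => (complex.Re
        (foldl (fun g X => lie_derive X g)
               (form_app theta (bracket L2 L1)) l' x))%:C)
  end.

(* the value at v in H10 S x, computed with any section through v *)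
Definition dual_form (S : set V) (theta : field) (l : seq field)
    (x : V) (v : CV) : C :=
  xget 0 [set c | exists (U : set V) (L : field),
    [/\ open U, U x, section S U (H10 S) L, L x = v &
        c = dual_form_on theta l L x]].

Definition E_dual (S U : set V) (theta : field) (E : V -> set CV) (t : nat)
    (omega : V -> CV -> C) : Prop :=
  (2 <= t)%N /\ exists l : seq field,
    [/\ size l = t.-1,
        (forall i, (i < size l)%N ->
          section S U E (nth (fun=> 0) l i) \/
          conj_section S U E (nth (fun=> 0) l i)) &
        omega = dual_form S theta l].

(* None stands for infinity. *)
Definition multi_order := (n.-1).-tuple (option nat).

Definition order_lt (a b : option nat) : Prop :=
  match a, b with
  | Some s, Some t => (s < t)%N
  | Some _, None => True
  | None, _ => False
  end.

Definition lex_lt (s t : multi_order) : Prop :=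
  exists k : 'I_n.-1, order_lt (tnth s k) (tnth t k) /\
    forall j : 'I_n.-1, (j < k)%N -> tnth s j = tnth t j.

Definition lex_le (s t : multi_order) : Prop := s = t \/ lex_lt s t.

(* The entry k of tau (counted from 0) is t_(k+1), attached to the passage
   from E k to E k.+1; only E 0, .., E m are meaningful. *)
Definition tower (S U : set V) (theta : field) (m : nat)
    (E : nat -> V -> set CV) (tau : multi_order) : Prop :=
  [/\ (m <= n.-1)%N,
      (forall x, U x -> S x -> E 0%N x = H10 S x),
      (forall k, (k <= m)%N -> exists r, subbundle S U r (E k)),
      (forall k : 'I_n.-1, (m <= k)%N -> tnth tau k = None) &
      forall k : 'I_n.-1, (k < m)%N ->
        exists (t : nat) (omega : V -> CV -> C),
          [/\ tnth tau k = Some t,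
              E_dual S U theta (E k) t omega,
              (forall x, U x -> S x -> exists v, E k x v /\ omega x v != 0) &
              forall x, U x -> S x ->
                E k.+1 x = E k x `&` [set v | omega x v = 0]]].

Definition tower_order_at (S : set V) (p : V) : set multi_order := [set tau |
  exists (U : set V) (theta : field) (m : nat) (E : nat -> V -> set CV),
    [/\ open U, U p, contact_form S U theta & tower S U theta m E tau]].

(* The lexicographic order is a well-order on multi-orders and the tower with
   m = 0 always exists, so the default value of [xget] plays no role. *)
Definition tower_multitype (S : set V) (p : V) : multi_order :=
  xget [tuple None | _ < n.-1] [set tau | tower_order_at S p tau /\
    forall sigma, tower_order_at S p sigma -> lex_le tau sigma].

Definition num_infinite (tau : multi_order) : nat :=
  count (fun t => t == None) tau.

(* Kernel of the Levi form (L, L') |-> [L, conj L'] mod CH S. *)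
Definition levi_kernel (S : set V) (x : V) : set CV := [set v |
  H10 S x v /\
  forall (U : set V) (L L' : field), open U -> U x ->
    section S U (H10 S) L -> section S U (H10 S) L' -> L x = v ->
    CH S x (bracket L (conjf L') x)].

Definition CR_submanifold (S M : set V) : Prop :=
  [/\ M `<=` S, submanifold M &
      exists d, forall x, M x -> has_dim (CT M x `&` H10 S x) d].

Definition q_regular_decomposition (S : set V) (q : nat) (I : countType)
    (S_ : I -> set V) : Prop :=
  [/\ S = \bigcup_k S_ k,
      trivIset [set: I] S_,
      (forall k, exists O F : set V,
        [/\ open O, closed F & S_ k = S `&` O `&` F]) &
      forall k p, S_ k p -> exists M : set V,
        [/\ CR_submanifold S M,
            (exists U, [/\ open U, U p & S_ k `&` U `<=` M]) &
            forall x, M x -> exists d, (d < q)%N /\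
              has_dim ((CT M x `&` H10 S x) `&` levi_kernel S x) d]].

Definition countably_q_regular (S : set V) (q : nat) : Prop :=
  exists (I : countType) (S_ : I -> set V), q_regular_decomposition S q S_.

Definition boundary (D : set V) : set V := closure D `\` D°.

Definition domain (D : set V) : Prop := [/\ open D, connected D & D !=set0].

Definition smooth_boundary (D : set V) : Prop :=
  forall p, boundary D p -> exists (U : set V) (rho : V -> R),
    [/\ open U, U p, smooth_on U rho,
        (forall x, U x -> exists v, 'D_v rho x != 0) &
        D `&` U = U `&` [set x | rho x < 0]].

End TowerMultitype.

Arguments multi_order n : clear implicits.

(* Main.v *)
Require Import Defs.
From mathcomp Require Import all_boot all_order all_algebra.
From mathcomp Require Import complex ring lra.
From mathcomp Require Import all_classical all_reals all_analysis.

Set Implicit Arguments.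
Unset Strict Implicit.
Unset Printing Implicit Defensive.

Import Order.TTheory GRing.Theory Num.Theory.
Import numFieldNormedType.Exports.

Local Open Scope classical_set_scope.
Local Open Scope ring_scope.

(* A tower at [p] is a tower at every nearby point, so [T] is upper semicontinuous
   for the lexicographic order and its level sets are locally closed.  Fix the minimal
   tower near [p], with dual forms [omega_k] on [E_(k-1)] of order [t_k].  If
   [t_k >= 3], then [omega_k] is the restriction of [d f_k] for a real function [f_k],
   and [f_k] vanishes at every point [x] with [T(x) = T(p)]: otherwise dropping the last
   vector field of the list gives a dual form of order [t_k - 1] that is nonzero at [x],
   hence a smaller tower near [x].  The [omega_k] are triangular with respect to the
   tower, so the common zero set [M] of these [f_k] in [S] is a CR submanifold of
   constant CR dimension.  If [t_k = 2], then [omega_k] vanishes on the Levi kernel.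
   Hence [H^10 M] meets the Levi kernel inside the last subbundle [E_m], whose rank
   [n - 1 - m] is the number of infinite entries of the multitype. *)

(** * Smooth functions *)

(** Dropping the last field of a list has one difficulty: a dual form sees only the real part of an
    iterated derivative $g$. If $L^t g\neq 0$ at $x$, then the differential of $\mathrm{Re}\,g$ or
    of $\mathrm{Im}\,g$ is nonzero on $L^t$, and replacing $L^1$ by $iL^1$ turns $g$ into $ig$, so
    both cases are real parts of admissible lists. The functions $f_k$ are real, while the covectors
    are triangular over $\mathbb{C}$ on $H^{10}S$. The passage between the two is that the
    derivative of a real function along $\mathrm{Re}\,v$ is the real part of its derivative along
    $v$. Tangent spaces are defined by testing against every smooth function that vanishes on the
    set. Their computation for a level set rests on finding zeros of the equations close to any
    tangent direction, which a minimization on a small cube provides. Dual forms are defined by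
    extending a vector to a section. They are first identified with pairings against smooth covector
    fields, so that nonvanishing is an open condition and kernels are subbundles. *)

Section RealCalculus.
Context {R : realType} {V W : normedModType R}.
Implicit Types (U : set V) (f g : V -> W).

Lemma near_eq_differentiable f g x :
  (\forall y \near x, f y = g y) -> differentiable f x -> differentiable g x.
Proof.
move=> fg df; have fgx := nbhs_singleton fg.
have cdf : continuous ('d f x) by exact: diff_continuous.
have gE : g \o shift x = cst (g x) + 'd f x +o_ (0 : V) id.
  apply/eqaddoP => _/posnumP[e].
  have /eqaddoP/(_ _ (gt0 e)) := diff_locally df.
  have fg0 : \forall h \near (0 : V), f (h + x) = g (h + x).
    by move: fg; rewrite (near_shift 0) /=; apply: filterS => h /=; rewrite subr0.
  by apply: filterS2 fg0 => h /= fgh; rewrite !fctE /= fgh fgx.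
by apply/diff_locallyP; rewrite (diff_unique cdf gE); split.
Qed.

Lemma open_near_eq U f g x :
  open U -> U x -> (forall y, U y -> f y = g y) -> \forall y \near x, f y = g y.
Proof. by move=> Uo Ux fg; apply: filterS (open_nbhs_nbhs (conj Uo Ux)). Qed.

Lemma eq_Ck_on k U f g :
  open U -> (forall y, U y -> f y = g y) -> Ck_on k U f -> Ck_on k U g.
Proof.
move=> Uo; elim: k f g => [|k IH] f g fg /=.
  move=> cf x Ux; rewrite /prop_for /= /continuous_at -(fg _ Ux).
  apply: cvg_trans (cf x Ux).
  by apply: near_eq_cvg; exact: (open_near_eq Uo Ux fg).
move=> [df Df]; split=> [x Ux|v].
  by apply: near_eq_differentiable (df x Ux); exact: (open_near_eq Uo Ux fg).
apply: IH (Df v) => x Ux.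
by apply: near_eq_derive; exact: (open_near_eq Uo Ux fg).
Qed.

Lemma eq_smooth_on U f g :
  open U -> (forall y, U y -> f y = g y) -> smooth_on U f -> smooth_on U g.
Proof. by move=> Uo fg sf k; exact: eq_Ck_on (sf k). Qed.

Lemma Ck_onS k U f : Ck_on k.+1 U f -> Ck_on k U f.
Proof.
elim: k f => [|k IH] f [df Df]; first by move=> x /df /differentiable_continuous.
by split=> // v; exact/IH/Df.
Qed.

Lemma sub_smooth_on U U' f : U' `<=` U -> smooth_on U f -> smooth_on U' f.
Proof.
move=> sU sf k; move: (sf k); elim: k f {sf} => [|k IH] f /=.
  by move=> cf x /sU; exact: cf.
by move=> [df Df]; split=> [x /sU /df //|v]; exact/IH/Df.
Qed.

Lemma smooth_differentiable U f x : smooth_on U f -> U x -> differentiable f x.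
Proof. by move=> /(_ 1%N) [df _] /df. Qed.

Lemma smooth_derivable U f x v : smooth_on U f -> U x -> derivable f x v.
Proof. by move=> sf Ux; apply/diff_derivable/(smooth_differentiable sf). Qed.

Lemma smooth_continuous U f x : smooth_on U f -> U x -> {for x, continuous f}.
Proof. by move=> /(_ 0%N); apply. Qed.

Lemma smooth_derive U f v : smooth_on U f -> smooth_on U (fun x => 'D_v f x).
Proof. by move=> sf k; case: (sf k.+1) => _; exact. Qed.

Lemma smooth_cst U (c : W) : smooth_on U (fun=> c).
Proof.
move=> k; elim: k c => [|k IH] c; first by move=> x _; exact: cvg_cst.
split=> [x _|v]; first exact: differentiable_cst.
have -> : (fun x => 'D_v (fun=> c) x) = (fun=> 0 : W); last exact: IH.
by apply/funext => x; exact: derive_cst.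
Qed.

Lemma Ck_on_add k U f g : open U ->
  Ck_on k U f -> Ck_on k U g -> Ck_on k U (fun x => f x + g x).
Proof.
move=> Uo; elim: k f g => [|k IH] f g /=.
  by move=> cf cg x Ux; apply: cvgD; [exact: cf|exact: cg].
move=> [df Df] [dg Dg]; split=> [x Ux|v].
  by apply: differentiableD; [exact: df|exact: dg].
apply: eq_Ck_on (IH _ _ (Df v) (Dg v)) => // x Ux.
by rewrite deriveD //; apply: diff_derivable; [exact: df|exact: dg].
Qed.

Lemma smooth_add U f g : open U ->
  smooth_on U f -> smooth_on U g -> smooth_on U (fun x => f x + g x).
Proof. by move=> Uo sf sg k; exact: Ck_on_add. Qed.

Lemma smooth_opp U f : open U -> smooth_on U f -> smooth_on U (fun x => - f x).
Proof.
move=> Uo sf k; move: (sf k); elim: k f {sf} => [|k IH] f /=.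
  by move=> cf x Ux; apply: cvgN; exact: cf.
move=> [df Df]; split=> [x Ux|v]; first by apply: differentiableN; exact: df.
apply: eq_Ck_on (IH _ (Df v)) => // x Ux.
by rewrite deriveN //; apply: diff_derivable; exact: df.
Qed.

Lemma smooth_sum U (I : Type) (r : seq I) (P : pred I) (F : I -> V -> W) :
  open U -> (forall i, P i -> smooth_on U (F i)) ->
  smooth_on U (fun x => \sum_(i <- r | P i) F i x).
Proof.
move=> Uo sF; elim: r => [|i r IH].
  by apply: eq_smooth_on (@smooth_cst U 0) => // y _; rewrite big_nil.
case Pi: (P i).
  by apply: eq_smooth_on (smooth_add Uo (sF _ Pi) IH) => // y _; rewrite big_cons Pi.
by apply: eq_smooth_on IH => // y _; rewrite big_cons Pi.
Qed.

End RealCalculus.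

Section ProductRule.
Context {R : realType} {V W : normedModType R}.
Implicit Types (U : set V) (f g : V -> R).

Lemma derive_sum_fun (I : Type) (r : seq I) (P : pred I) (F : I -> V -> W) x v :
  (forall i, P i -> derivable (F i) x v) ->
  'D_v (fun y => \sum_(i <- r | P i) F i y) x =
  \sum_(i <- r | P i) 'D_v (F i) x.
Proof.
move=> dF.
suff [] : derivable (fun y => \sum_(i <- r | P i) F i y) x v /\
  'D_v (fun y => \sum_(i <- r | P i) F i y) x =
  \sum_(i <- r | P i) 'D_v (F i) x by [].
elim: r => [|i r [IHd IHD]].
  under eq_fun do rewrite big_nil; rewrite big_nil.
  by split; [exact: derivable_cst|exact: derive_cst].
under eq_fun do rewrite big_cons; rewrite big_cons.
case Pi: (P i); last by split.
by rewrite -IHD; split; [apply: derivableD => //; exact: dF|rewrite deriveD //; exact: dF].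
Qed.

Lemma smooth_mul U f g : open U ->
  smooth_on U f -> smooth_on U g -> smooth_on U (fun x => f x * g x).
Proof.
move=> Uo sf sg k; move: (sf k) (sg k); elim: k f g {sf sg} => [|k IH] f g /=.
  by move=> cf cg x Ux; apply: cvgM; [exact: cf|exact: cg].
move=> fk gk; have [df Df] := fk; have [dg Dg] := gk; split=> [x Ux|v].
  by apply: differentiableM; [exact: df|exact: dg].
(* The undifferentiated factors enter the induction hypothesis at order [k], one less than the order
   they have. *)
have smul : Ck_on k U (fun x => f x * 'D_v g x + g x * 'D_v f x).
  by apply: Ck_on_add => //; apply: IH => //; exact: Ck_onS.
apply: eq_Ck_on smul => // x Ux.
by rewrite deriveM //; apply: diff_derivable; [exact: df|exact: dg].
Qed.

Lemma smooth_scale U f (w : W) : open U ->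
  smooth_on U f -> smooth_on U (fun x => f x *: w).
Proof.
move=> Uo sf k; move: (sf k); elim: k f {sf} => [|k IH] f /=.
  by move=> cf x Ux; apply: cvgZr_tmp; exact: cf.
move=> [df Df]; split=> [x Ux|v]; first by apply: differentiableZl; exact: df.
apply: eq_Ck_on (IH _ (Df v)) => // x Ux.
have dfx := df x Ux.
by rewrite !deriveE ?diffZl //; exact: differentiableZl.
Qed.

End ProductRule.

(** * Tangent vectors of level sets *)

Section TangentSpace.
Context {R : realType} {V : normedModType R}.
Implicit Types (U : set V) (f g : V -> R).

Lemma derive_dirD (f : V -> R) x v w : differentiable f x ->
  'D_(v + w) f x = 'D_v f x + 'D_w f x.
Proof. by move=> df; rewrite !deriveE // linearD. Qed.

Lemma derive_dirZ (f : V -> R) x (a : R) v : differentiable f x ->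
  'D_(a *: v) f x = a * 'D_v f x.
Proof. by move=> df; rewrite !deriveE // linearZ. Qed.

Lemma derive_dir_sum (f : V -> R) x (I : Type) (r : seq I) (P : pred I)
    (a : I -> R) (v : I -> V) : differentiable f x ->
  'D_(\sum_(i <- r | P i) a i *: v i) f x = \sum_(i <- r | P i) a i * 'D_(v i) f x.
Proof.
move=> df; rewrite deriveE // linear_sum; apply: eq_bigr => i _.
by rewrite linearZ deriveE.
Qed.

Lemma differentiable_expansion (f : V -> R) x e : differentiable f x -> 0 < e ->
  exists2 d, 0 < d & forall h, `|h| < d -> `|f (x + h) - f x - 'D_h f x| <= e * `|h|.
Proof.
move=> df e0; have /eqaddoP/(_ _ e0)/nbhs_ballP[d d0 dP] := diff_locally df.
exists d => // h hd; have := dP h.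
rewrite -ball_normE /= sub0r normrN => /(_ hd).
by rewrite deriveE // !fctE /= [h + x]addrC opprD addrA.
Qed.

Lemma derive_ge0_at_min (f : V -> R) y v : derivable f y v ->
  (\forall r \near (0 : R), f y <= f (r *: v + y)) -> 0 <= 'D_v f y.
Proof.
move=> dfv fmin; rewrite /derive cvg_at_rightE //.
apply: limr_ge.
  by move/cvg_ex: dfv => [l dl]; apply/cvg_ex; exists l; exact: cvg_dnbhs_at_right.
have fmin' : \forall r \near 0^'+, f y <= f (r *: v + y) by apply: cvg_within fmin.
near=> r; apply: mulr_ge0; first by rewrite invr_ge0.
by rewrite subr_ge0; near: r; exact: fmin'.
Unshelve. all: by end_near. Qed.

Lemma derive_eq0_at_min (f : V -> R) y v : differentiable f y ->
  (\forall r \near (0 : R), f y <= f (r *: v + y)) -> 'D_v f y = 0.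
Proof.
move=> df fmin; apply/eqP; rewrite eq_le; apply/andP; split; last first.
  by apply: derive_ge0_at_min => //; exact: diff_derivable.
rewrite -oppr_ge0 -mulN1r -derive_dirZ // scaleN1r.
apply: derive_ge0_at_min; first exact: diff_derivable.
move/nbhs_ballP: fmin => [d d0 dP]; apply/nbhs_ballP; exists d => // r.
rewrite -ball_normE /= => rd; rewrite scalerN -scaleNr; apply: dP.
by rewrite -ball_normE /= opprK add0r; rewrite sub0r normrN in rd.
Qed.

Lemma near0_add (x : V) (P : set V) :
  (\forall y \near x, P y) -> \forall h \near (0 : V), P (x + h).
Proof.
by rewrite (near_shift 0) /=; apply: filterS => h /=; rewrite subr0 addrC.
Qed.

(* On the cube [|s_j| <= e t] the function [s |-> \sum_j F_j ^ 2] at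
   [x + t w + \sum_j s_j v_j] is larger on the boundary than at [s = 0], so it has
   an interior minimum, where [F = 0] because the [v_j]-derivatives of [F] are
   close to the standard basis. *)
Lemma zero_near_tangent c U (F : 'I_c -> V -> R) (v : 'I_c -> V) x w (e : R) :
  open U -> U x -> (forall j, smooth_on U (F j)) -> (forall j, F j x = 0) ->
  (forall i j, 'D_(v i) (F j) x = (i == j)%:R) ->
  (forall j, 'D_w (F j) x = 0) -> 0 < e ->
  exists2 t0 : R, 0 < t0 & forall t : R, 0 < t < t0 -> exists s : 'I_c -> R,
    [/\ forall j, `|s j| <= e * t, U (x + (t *: w + \sum_j s j *: v j)) &
        forall j, F j (x + (t *: w + \sum_j s j *: v j)) = 0].
Proof.
move=> Uo Ux sF Fx vF wF e0.
pose K := \sum_j `|v j|; pose N := `|w| + e * K + 1.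
have K0 : 0 <= K by apply: sumr_ge0.
have N0 : 0 < N by rewrite /N ltr_wpDl // addr_ge0 // mulr_ge0 // ltW.
(* On the cube the displacement has norm at most [t * N], so the error [eta] of the linear expansion
   becomes at most e t / (c + 2), called [del] below. *)
pose eta := e / (c.+2%:R * N).
have eta0 : 0 < eta by rewrite divr_gt0 // mulr_gt0.
(* The property that matters is c * kap < 1: it makes the linear system for the values [F j] at the
   minimum contracting. *)
pose kap : R := (2 * c.+1%:R)^-1.
have kap0 : 0 < kap by rewrite invr_gt0 mulr_gt0.
have expF : \forall h \near (0 : V), forall j,
    `|F j (x + h) - 'D_h (F j) x| <= eta * `|h|.
  apply: filter_forall => j; have dFj := smooth_differentiable (sF j) Ux.
  have [d d0 dP] := differentiable_expansion dFj eta0.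
  apply/nbhs_ballP; exists d => // h; rewrite -ball_normE /= sub0r normrN.
  by move=> /dP; rewrite Fx subr0.
have Dnear : \forall h \near (0 : V), forall ij : 'I_c * 'I_c,
    `|'D_(v ij.1) (F ij.2) (x + h) - (ij.1 == ij.2)%:R| <= kap.
  apply: filter_forall => -[i j] /=.
  have /cvgrPdist_le/(_ _ kap0) := smooth_continuous (smooth_derive (v i) (sF j)) Ux.
  by move=> /near0_add; apply: filterS => h /=; rewrite vF distrC.
have Unear : \forall h \near (0 : V), U (x + h).
  by apply: near0_add; exact: open_nbhs_nbhs.
have [d /= d0 dP] := (nbhs_ballP _ _).1 (filterI expF (filterI Dnear Unear)).
exists (d / N); first exact: divr_gt0.
move=> t /andP[t0 td].
pose P (s : 'rV[R]_c) := x + (t *: w + \sum_j s ord0 j *: v j).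
pose A := [set s : 'rV[R]_c | forall j, `[- (e * t), e * t]%classic (s ord0 j)].
have AE s : A s <-> forall j, `|s ord0 j| <= e * t.
  by split=> sA j; move: (sA j); rewrite /= in_itv /= ler_norml.
have Pball s : A s -> `|t *: w + \sum_j s ord0 j *: v j| <= t * N.
  move=> /AE sA; rewrite (le_trans (ler_normD _ _)) //.
  rewrite normrZ (gtr0_norm t0) /N !mulrDr mulr1 -addrA lerD2l.
  rewrite (le_trans (ler_norm_sum _ _ _)) //.
  apply: (@le_trans _ _ (t * (e * K))); last by rewrite lerDl ltW.
  rewrite /K !mulr_sumr; apply: ler_sum => j _.
  by rewrite normrZ mulrA (mulrC t e) ler_wpM2r.
have Ad s : A s -> `|t *: w + \sum_j s ord0 j *: v j| < d.
  by move=> /Pball /le_lt_trans; apply; rewrite -ltr_pdivlMr.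
have {}dP s : A s -> [/\ forall j, `|F j (P s) - s ord0 j| <= e * t / c.+2%:R,
    forall i j, `|'D_(v i) (F j) (P s) - (i == j)%:R| <= kap & U (P s)].
  move=> As; have := dP (t *: w + \sum_j s ord0 j *: v j).
  rewrite -ball_normE /= sub0r normrN => /(_ (Ad _ As)) [Fe [De US]].
  split=> // [j|i j]; last exact: (De (i, j)).
  have dFj := smooth_differentiable (sF j) Ux.
  have Ds : 'D_(\sum_j s ord0 j *: v j) (F j) x = s ord0 j.
    rewrite derive_dir_sum // (bigD1 j) //= vF eqxx mulr1 big1 ?addr0 //.
    by move=> i ij; rewrite vF (negbTE ij) mulr0.
  have := Fe j; rewrite derive_dirD // derive_dirZ // wF mulr0 add0r Ds.
  move=> /le_trans; apply; rewrite (le_trans (ler_wpM2l (ltW eta0) (Pball _ As))) //.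
  have -> // : eta * (t * N) = e * t / c.+2%:R.
  rewrite /eta; move: (N) N0 (c.+2%:R : R) (ltr0Sn R c.+1) => n n0 m m0.
  by field; rewrite !gt_eqF.
set del := e * t / c.+2%:R in dP.
have del0 : 0 < del by rewrite divr_gt0 // mulr_gt0.
have etE : e * t = c.+2%:R * del by rewrite /del [RHS]mulrC divfK ?pnatr_eq0.
pose phi (s : 'rV[R]_c) := \sum_j F j (P s) * F j (P s).
have cA : compact A by apply: (@rV_compact _ _ (fun=> `[- (e * t), e * t]%classic)) => j; exact: segment_compact.
have A0 : A 0 by apply/AE => j; rewrite mxE normr0 mulr_ge0 ?ltW.
have cP : continuous P.
  have cs : continuous (fun s : 'rV[R]_c => \sum_j s ord0 j *: v j).
    apply: continuous_big => [|j _ s]; first exact: add_continuous.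
    exact: (cvgZr_tmp (@coord_continuous R 1 c ord0 j s)).
  by move=> s; exact: (cvgD (cvg_cst x) (cvgD (cvg_cst (t *: w)) (cs s))).
have smPhi : smooth_on U (fun y => \sum_i F i y * F i y).
  by apply: smooth_sum => // i _; exact: smooth_mul.
have phic : {within A, continuous phi}.
  apply: continuous_in_subspaceT => s; rewrite inE => As; have [_ _ UP] := dP _ As.
  exact: (continuous_comp (cP s) (smooth_continuous smPhi UP)).
have [s As smin] := EVT_min_rV (ex_intro _ _ A0) cA phic.
rewrite inE in As.
have [FP DP UP] := dP _ As.
have phi_s : phi s <= c%:R * (del * del).
  apply: le_trans (smin 0 _) _; first by rewrite inE.
  have -> : c%:R * (del * del) = \sum_(j < c) del * del.
    by rewrite sumr_const card_ord mulr_natl.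
  apply: ler_sum => j _; have [/(_ j) + _ _] := dP _ A0.
  rewrite mxE subr0 => Fj.
  by rewrite (le_trans (ler_norm _)) // normrM ler_pM.
(* On the face |s_j| = e t = (c + 2) del one has |F_j| >= (c + 1) del, so [phi] is at least (c +
   1)^2 del^2 there. This exceeds c del^2, which bounds [phi] at 0 and hence at its minimum. *)
have sint j : `|s ord0 j| < e * t.
  rewrite lt_neqAle ((AE s).1 As) andbT; apply/negP => /eqP sj.
  have Fj : c.+1%:R * del <= `|F j (P s)|.
    have := FP j; rewrite distrC => /(le_trans (lerB_dist _ _)).
    by rewrite sj etE -natr1 mulrDl mul1r addrAC gerDr subr_le0.
  have : (c.+1%:R * del) * (c.+1%:R * del) <= phi s.
    rewrite /phi (bigD1 j) //= -[leLHS]addr0 lerD ?sumr_ge0 //; last first.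
      by move=> i _; rewrite -expr2 sqr_ge0.
    by rewrite -[leRHS]ger0_norm -?expr2 ?sqr_ge0 // expr2 normrM ler_pM // mulr_ge0 ?ltW.
  move=> /le_trans/(_ phi_s); rewrite mulrACA ler_pM2r ?mulr_gt0 //.
  by rewrite -natrM ler_nat mulnS addSn ltnNge leq_addr.
have Dphi j : \sum_i F i (P s) * 'D_(v j) (F i) (P s) = 0.
  have dF i : differentiable (F i) (P s) by exact: smooth_differentiable UP.
  pose Phi (i : 'I_c) y := F i y * F i y.
  have dPhi i : differentiable (Phi i) (P s) by exact: differentiableM.
  have : 'D_(v j) (fun y => \sum_i Phi i y) (P s) = 0.
    apply: derive_eq0_at_min; first exact: smooth_differentiable UP.
    apply/nbhs_ballP; exists (e * t - `|s ord0 j|); first by rewrite /= subr_gt0.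
    move=> r; rewrite -ball_normE /= sub0r normrN => rs.
    have -> : r *: v j + P s = P (s + r *: delta_mx ord0 j).
      rewrite /P addrCA [r *: _ + _]addrC -addrA; congr (_ + (_ + _)).
      rewrite (bigD1 j) //= [in RHS](bigD1 j) //= !mxE !eqxx mulr1 scalerDl.
      rewrite addrAC; congr (_ + _); apply: eq_bigr => i ij.
      by rewrite !mxE (negbTE ij) mulr0 addr0.
    apply: (smin (s + r *: delta_mx ord0 j)); rewrite inE; apply/AE => i.
    rewrite !mxE eqxx /=; case: eqP => [->|_]; last by rewrite mulr0 addr0 ltW.
    rewrite mulr1 (le_trans (ler_normD _ _)) // addrC -lerBrDr; exact: ltW.
  rewrite derive_sum_fun => [|i _]; last exact: diff_derivable.
  have DPhi i : 'D_(v j) (Phi i) (P s) =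
      F i (P s) * 'D_(v j) (F i) (P s) + F i (P s) * 'D_(v j) (F i) (P s).
    by rewrite /Phi deriveM //; exact: diff_derivable.
  rewrite (eq_bigr _ (fun i _ => DPhi i)) big_split /= -mulr2n => /eqP.
  by rewrite mulrn_eq0 /= => /eqP.
exists (fun j => s ord0 j); split=> //; first exact/AE.
pose S := \sum_j `|F j (P s)|.
(* Vanishing of the gradient of [phi] gives F_j = sum_i F_i (delta_ij - D_(v_j) F_i), hence the
   bound; summing over j yields S <= c * kap * S. *)
have FS j : `|F j (P s)| <= kap * S.
  have -> : F j (P s) = \sum_i F i (P s) * ((j == i)%:R - 'D_(v j) (F i) (P s)).
    under eq_bigr do rewrite mulrBr.
    rewrite big_split /= sumrN Dphi subr0 (bigD1 j) //= eqxx mulr1 big1 ?addr0 //.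
    by move=> i; rewrite eq_sym => /negbTE ->; rewrite mulr0.
  rewrite (le_trans (ler_norm_sum _ _ _)) // mulr_sumr; apply: ler_sum => i _.
  by rewrite normrM mulrC ler_wpM2r // distrC.
have S0 : S <= 0.
  have : S <= \sum_(j < c) kap * S by apply: ler_sum => j _.
  rewrite sumr_const card_ord -mulr_natl mulrA -subr_le0 -{1}[S]mul1r -mulrBl.
  rewrite pmulr_rle0 // subr_gt0 /kap ltr_pdivrMr ?mulr_gt0 // mul1r.
  by rewrite -natrM ltr_nat mul2n -addnn ltn_addl.
move=> j; rewrite -[x + _]/(P s).
apply/eqP; rewrite -normr_le0 (le_trans _ S0) // /S (bigD1 j) //=.
by rewrite lerDl sumr_ge0.
Qed.

End TangentSpace.

Section TangentSpaceZeros.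
Context {R : realType} {V : normedModType R}.
Implicit Types (U : set V) (f g : V -> R).

(** For every e in (0, 1] and small t there is a common zero of the [F j] at x + t w + O(e t), and
    [g] vanishes there. The first-order expansion of [g] bounds its derivative along [w] by a fixed
    multiple of e. This is the part of the implicit function theorem that tangent spaces of level
    sets require. *)
Lemma derive_eq0_on_zeros c U (F : 'I_c -> V -> R) g x w :
  open U -> U x -> (forall j, smooth_on U (F j)) -> (forall j, F j x = 0) ->
  (forall u : 'I_c -> R, exists v, forall j, 'D_v (F j) x = u j) ->
  differentiable g x -> (forall y, U y -> (forall j, F j y = 0) -> g y = 0) ->
  (forall j, 'D_w (F j) x = 0) -> 'D_w g x = 0.
Proof.
move=> Uo Ux sF Fx surF dg gF wF.
have /choice[v vF] : forall i, exists v, forall j, 'D_v (F j) x = (i == j)%:R.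
  by move=> i; exact: (surF (fun j => (i == j)%:R)).
have gx : g x = 0 by exact: gF.
pose L := \sum_j `|'D_(v j) g x|; pose K := \sum_j `|v j|.
have L0 : 0 <= L by exact: sumr_ge0.
have K0 : 0 <= K by exact: sumr_ge0.
have small e : 0 < e -> e <= 1 -> `|'D_w g x| <= e * (L + (`|w| + K)).
  move=> e0 e1.
  have [t0 t00 t0P] := zero_near_tangent Uo Ux sF Fx vF wF e0.
  have [d d0 dP] := differentiable_expansion dg e0.
  have wK0 : 0 < `|w| + K + 1 by rewrite ltr_wpDl // addr_ge0.
  (* Half the minimum lies strictly below both thresholds; the summand 1 keeps the denominator
     positive. *)
  pose t := Num.min t0 (d / (`|w| + K + 1)) / 2.
  have m0 : 0 < Num.min t0 (d / (`|w| + K + 1)) by rewrite lt_min t00 divr_gt0.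
  have tm : t < Num.min t0 (d / (`|w| + K + 1)).
    by rewrite /t ltr_pdivrMr // mulr_natr mulr2n ltrDl.
  have t_gt0 : 0 < t by rewrite /t divr_gt0.
  move: tm; rewrite lt_min => /andP[tt0 td].
  have [s [se Us Fs]] := t0P t ltac:(by rewrite t_gt0).
  pose h := t *: w + \sum_j s j *: v j.
  have hle : `|h| <= t * (`|w| + K).
    rewrite (le_trans (ler_normD _ _)) // normrZ (gtr0_norm t_gt0) mulrDr lerD2l.
    rewrite (le_trans (ler_norm_sum _ _ _)) // mulr_sumr; apply: ler_sum => j _.
    rewrite normrZ ler_wpM2r // (le_trans (se j)) //.
    by rewrite ler_piMl // ltW.
  have hd : `|h| < d.
    apply: (le_lt_trans hle); apply: (@le_lt_trans _ _ (t * (`|w| + K + 1))).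
      by rewrite ler_pM2l // lerDl.
    by rewrite -ltr_pdivlMr.
  have := dP h hd; rewrite gF // gx subr0 sub0r normrN => hg.
  have DhE : 'D_h g x = t * 'D_w g x + \sum_j s j * 'D_(v j) g x.
    by rewrite derive_dirD // derive_dirZ // derive_dir_sum.
  have : t * `|'D_w g x| <= t * (e * (L + (`|w| + K))).
    have -> : t * `|'D_w g x| = `|'D_h g x - \sum_j s j * 'D_(v j) g x|.
      by rewrite DhE addrK normrM (gtr0_norm t_gt0).
    rewrite (le_trans (ler_normB _ _)) //.
    rewrite [L + _]addrC mulrDr mulrDr lerD //.
      by rewrite (le_trans hg) // mulrCA ler_wpM2l // ltW.
    rewrite (le_trans (ler_norm_sum _ _ _)) // mulrA (mulrC t) mulr_sumr.
    apply: ler_sum => j _.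
    by rewrite normrM ler_wpM2r.
  by rewrite ler_pM2l.
apply/eqP; rewrite -normr_le0 leNgt; apply/negP => D0.
pose X := L + (`|w| + K) + `|'D_w g x|.
have X0 : 0 < X by rewrite /X ltr_wpDl // !addr_ge0.
(* For this e the bound reads 2 X <= L + (|w| + K), which is impossible since X is that sum plus a
   positive number. *)
have := small (`|'D_w g x| / (2 * X)).
have le1 : `|'D_w g x| / (2 * X) <= 1.
  rewrite ler_pdivrMr ?mulr_gt0 // mul1r /X mulrDr ler_wpDl ?mulr_ge0 ?addr_ge0 //.
  by rewrite mulr_natl mulr2n lerDl.
have e0 : 0 < `|'D_w g x| / (2 * X) by rewrite divr_gt0 ?mulr_gt0.
move=> /(_ e0 le1); rewrite -mulrA ler_pMr // ler_pdivlMl ?mulr_gt0 // mulr1 /X.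
have := addr_ge0 L0 (addr_ge0 (normr_ge0 w) K0).
by move: D0; move: `|'D_w g x| (L + _) => a b; lra.
Qed.

End TangentSpaceZeros.

(** * Symmetry of second derivatives *)

Section MixedPartials.
Context {R : realType} {V : normedModType R}.
Implicit Types (U : set V) (f : V -> R).

Lemma is_derive_line f x v r : derivable f (x + r *: v) v ->
  is_derive r (1 : R) (fun r => f (x + r *: v)) ('D_v f (x + r *: v)).
Proof.
have E : (fun h : R => h^-1 *: (((fun r => f (x + r *: v)) \o shift r) (h *: (1 : R)) -
    f (x + r *: v))) =
  (fun h : R => h^-1 *: ((f \o shift (x + r *: v)) (h *: v) - f (x + r *: v))).
  apply/funext => h /=; do 3 f_equal.
  by rewrite -[h%:A]/(h * 1) mulr1 scalerDl addrCA.
by move=> df; split; rewrite /derivable /derive E.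
Qed.

Lemma mean_value_line f x v s : 0 < s ->
  (forall r, 0 <= r <= s -> derivable f (x + r *: v) v) ->
  exists2 r, 0 < r < s & f (x + s *: v) - f x = s * 'D_v f (x + r *: v).
Proof.
move=> s0 df.
have [||r] := @MVT R (fun r => f (x + r *: v)) (fun r => 'D_v f (x + r *: v)) 0 s s0.
- move=> r; rewrite in_itv /= => /andP[r0 rs].
  by apply: is_derive_line; apply: df; rewrite !ltW.
- apply: derivable_within_continuous => r; rewrite in_itv /= => rs.
  by have [] := is_derive_line (df _ rs).
by rewrite in_itv /= scale0r addr0 subr0 mulrC => rs E; exists r.
Qed.

Lemma derivable_translate f a y v :
  derivable f (y + a) v -> derivable (fun z => f (z + a)) y v.
Proof. by rewrite /derivable /= => df; under eq_fun do rewrite -addrA. Qed.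

Lemma derive_translate f a y v : 'D_v (fun z => f (z + a)) y = 'D_v f (y + a).
Proof. by rewrite /derive /=; under eq_fun do rewrite -addrA. Qed.

(** The mean value theorem is applied twice: along [u] to the increment y |-> f (y + t v) - f y,
    then along [v] to the derivative of [f] along [u]. *)
Lemma second_difference U f x u v (t : R) : smooth_on U f -> 0 < t ->
  (forall a b : R, 0 <= a <= t -> 0 <= b <= t -> U (x + a *: u + b *: v)) ->
  exists a b, [/\ 0 <= a <= t, 0 <= b <= t &
    f (x + t *: u + t *: v) - f (x + t *: u) - (f (x + t *: v) - f x) =
    t * (t * 'D_v (fun y => 'D_u f y) (x + a *: u + b *: v))].
Proof.
move=> sf t0 box.
have tt : 0 <= t <= t by rewrite lexx ltW.
have t00 : (0 : R) <= 0 <= t by rewrite lexx ltW.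
have [r rt] : exists2 r, 0 < r < t & f (x + t *: u + t *: v) - f (x + t *: u) -
    (f (x + t *: v) - f x) =
    t * 'D_u (fun y => f (y + t *: v) - f y) (x + r *: u).
  apply: (mean_value_line (f := fun y => f (y + t *: v) - f y)) => // r rt.
  apply: derivableB; first apply: derivable_translate.
    exact: (smooth_derivable sf (box _ _ rt tt)).
  apply: (smooth_derivable sf); rewrite -[x + _]addr0 -(scale0r v); exact: box.
have rt' : 0 <= r <= t by case/andP: rt => *; rewrite !ltW.
have Ur0 : U (x + r *: u) by rewrite -[x + _]addr0 -(scale0r v); exact: box.
rewrite deriveB; first last.
- exact: (smooth_derivable sf).
- by apply: derivable_translate; apply: (smooth_derivable sf); exact: box.
rewrite derive_translate => ->.
have [s st] : exists2 s, 0 < s < t &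
    'D_u f (x + r *: u + t *: v) - 'D_u f (x + r *: u) =
    t * 'D_v (fun y => 'D_u f y) (x + r *: u + s *: v).
  apply: (mean_value_line (f := fun y => 'D_u f y)) => // s st.
  by apply: (smooth_derivable (smooth_derive u sf)); exact: box.
move=> ->; exists r, s; split=> //.
by case/andP: st => *; rewrite !ltW.
Qed.

(** The second difference over a small parallelogram is symmetric in [u] and [v]. By
    [second_difference] it is t^2 times either mixed derivative at some nearby point, and both mixed
    derivatives are continuous at [x]. *)
Lemma derive_comm U f x u v : open U -> U x -> smooth_on U f ->
  'D_u (fun y => 'D_v f y) x = 'D_v (fun y => 'D_u f y) x.
Proof.
move=> Uo Ux sf; apply/eqP; rewrite -subr_eq0 -normr_le0 leNgt; apply/negP => ab0.
set a := 'D_u _ x in ab0; set b := 'D_v _ x in ab0.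
pose e := `|a - b| / 2.
have e0 : 0 < e by rewrite divr_gt0.
have na : \forall h \near (0 : V), `|a - 'D_u (fun y => 'D_v f y) (x + h)| < e.
  have := smooth_continuous (smooth_derive u (smooth_derive v sf)) Ux.
  by move=> /cvgrPdist_lt/(_ _ e0)/near0_add.
have nb : \forall h \near (0 : V), `|b - 'D_v (fun y => 'D_u f y) (x + h)| < e.
  have := smooth_continuous (smooth_derive v (smooth_derive u sf)) Ux.
  by move=> /cvgrPdist_lt/(_ _ e0)/near0_add.
have nU : \forall h \near (0 : V), U (x + h).
  by apply: near0_add; exact: open_nbhs_nbhs.
have [d /= d0 dP] := (nbhs_ballP _ _).1 (filterI na (filterI nb nU)).
pose N := `|u| + `|v| + 1.
have N0 : 0 < N by rewrite ltr_wpDl // addr_ge0.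
pose t := d / N / 2.
have t0 : 0 < t by rewrite !divr_gt0.
have ball_small p q : 0 <= p <= t -> 0 <= q <= t -> ball 0 d (p *: u + q *: v).
  move=> /andP[p0 pt] /andP[q0 qt]; rewrite -ball_normE /= sub0r normrN.
  rewrite (le_lt_trans (ler_normD _ _)) // !normrZ !ger0_norm //.
  apply: (@le_lt_trans _ _ (t * N)).
    by rewrite /N !mulrDr mulr1 ler_wpDr ?(ltW t0) // lerD // ler_wpM2r.
  by rewrite /t mulrAC divfK ?gt_eqF // ltr_pdivrMr // ltr_pMr // ltr1n.
have box p q : 0 <= p <= t -> 0 <= q <= t -> U (x + p *: u + q *: v).
  by move=> pt qt; rewrite -addrA; have [_ []] := dP _ (ball_small _ _ pt qt).
have box' p q : 0 <= p <= t -> 0 <= q <= t -> U (x + p *: v + q *: u).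
  by move=> pt qt; rewrite addrAC; exact: box.
have [p1 [q1 [p1t q1t E1]]] := second_difference sf t0 box.
have [p2 [q2 [p2t q2t]]] := second_difference sf t0 box'.
have swap (A B C E : R) : A - B - (C - E) = A - C - (B - E) by ring.
rewrite (addrAC x) swap => E2.
have E : 'D_v (fun y => 'D_u f y) (x + p1 *: u + q1 *: v) =
    'D_u (fun y => 'D_v f y) (x + p2 *: v + q2 *: u).
  apply: (mulfI (lt0r_neq0 t0)); apply: (mulfI (lt0r_neq0 t0)).
  exact: (etrans (esym E1) E2).
have [_ [+ _]] := dP _ (ball_small _ _ p1t q1t).
have [+ _] := dP _ (ball_small _ _ q2t p2t).
rewrite !addrA (addrAC x (q2 *: u)) E => A.
rewrite distrC => B.
have : `|a - b| < e + e.
  exact: (le_lt_trans (ler_distD _ _ _) (ltrD A B)).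
by rewrite -splitr ltxx.
Qed.

End MixedPartials.

(** * Complex-valued functions *)

Local Open Scope complex_scope.

Section ComplexCalculus.
Context {R : realType} {n : nat}.
Local Notation V := (pt R n).
Local Notation CV := (cvec R n).
Local Notation C := (R[i]).
Implicit Types (U : set V) (f g : V -> C) (u v w : CV) (x : V).

Lemma complex_eqP (a b : C) :
  complex.Re a = complex.Re b -> complex.Im a = complex.Im b -> a = b.
Proof. by case: a b => [? ?] [? ?] /= -> ->. Qed.

Lemma ReD (a b : C) : complex.Re (a + b) = complex.Re a + complex.Re b.
Proof. by case: a b => [? ?] [? ?]. Qed.

Lemma ImD (a b : C) : complex.Im (a + b) = complex.Im a + complex.Im b.
Proof. by case: a b => [? ?] [? ?]. Qed.

Lemma ReM (a b : C) : complex.Re (a * b) =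
  complex.Re a * complex.Re b - complex.Im a * complex.Im b.
Proof. by case: a b => [? ?] [? ?]. Qed.

Lemma ImM (a b : C) : complex.Im (a * b) =
  complex.Re a * complex.Im b + complex.Im a * complex.Re b.
Proof. by case: a b => [? ?] [? ?]. Qed.

Lemma Re_conj (a : C) : complex.Re a^* = complex.Re a. Proof. by case: a. Qed.

Lemma Im_conj (a : C) : complex.Im a^* = - complex.Im a. Proof. by case: a. Qed.

Definition cpart (j : 'I_(n + n)) f x : C :=
  'D_(delta_mx ord0 j) (fun y => complex.Re (f y)) x +i*
  'D_(delta_mx ord0 j) (fun y => complex.Im (f y)) x.

Lemma cderiveE f x v : cderive f x v = \sum_j v ord0 j * cpart j f x.
Proof. by []. Qed.

Section Domain.
Variables (U : set V) (Uo : open U).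

Lemma csmooth_real (h : V -> R) : smooth_on U h -> csmooth_on U (fun x => (h x)%:C).
Proof. by move=> sh; split=> //=; exact: smooth_cst. Qed.

Lemma csmooth_Re f : csmooth_on U f -> csmooth_on U (fun x => (complex.Re (f x))%:C).
Proof. by move=> [sr _]; exact: csmooth_real. Qed.

Lemma csmooth_cst (c : C) : csmooth_on U (fun=> c).
Proof. by split; exact: smooth_cst. Qed.

Lemma csmooth_add f g : csmooth_on U f -> csmooth_on U g ->
  csmooth_on U (fun x => f x + g x).
Proof.
move=> [fr fi] [gr gi]; split.
  by under eq_fun do rewrite ReD; exact: smooth_add.
by under eq_fun do rewrite ImD; exact: smooth_add.
Qed.

Lemma csmooth_mul f g : csmooth_on U f -> csmooth_on U g ->
  csmooth_on U (fun x => f x * g x).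
Proof.
move=> [fr fi] [gr gi]; split.
  under eq_fun do rewrite ReM; apply: smooth_add => //; first exact: smooth_mul.
  by apply: smooth_opp => //; exact: smooth_mul.
by under eq_fun do rewrite ImM; apply: smooth_add => //; exact: smooth_mul.
Qed.

Lemma csmooth_opp f : csmooth_on U f -> csmooth_on U (fun x => - f x).
Proof.
move=> sf; under eq_fun do rewrite -mulN1r.
by apply: csmooth_mul => //; exact: csmooth_cst.
Qed.

Lemma csmooth_conj f : csmooth_on U f -> csmooth_on U (fun x => (f x)^*).
Proof.
move=> [fr fi]; split; first by under eq_fun do rewrite Re_conj.
by under eq_fun do rewrite Im_conj; exact: smooth_opp.
Qed.

Lemma csmooth_sum (I : Type) (r : seq I) (P : pred I) (F : I -> V -> C) :
  (forall i, P i -> csmooth_on U (F i)) ->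
  csmooth_on U (fun x => \sum_(i <- r | P i) F i x).
Proof.
move=> sF; elim: r => [|i r IH].
  by under eq_fun do rewrite big_nil; exact: csmooth_cst.
under eq_fun do rewrite big_cons; case Pi: (P i) => //.
by apply: csmooth_add => //; exact: sF.
Qed.

Lemma csmooth_cpart j f : csmooth_on U f -> csmooth_on U (cpart j f).
Proof. by move=> [fr fi]; split => /=; exact: smooth_derive. Qed.

Lemma csmooth_cderive f (X : V -> CV) : csmooth_on U f -> smooth_field_on U X ->
  csmooth_on U (lie_derive X f).
Proof.
by move=> sf sX; apply: csmooth_sum => j _; apply: csmooth_mul => //; exact: csmooth_cpart.
Qed.

Lemma eq_cpart j f g x : U x -> (forall y, U y -> f y = g y) -> cpart j f x = cpart j g x.
Proof.
move=> Ux fg; rewrite /cpart; congr (_ +i* _); apply: near_eq_derive;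
  by apply: (@open_near_eq _ _ _ U) => // y /fg ->.
Qed.

Lemma eq_cderive f g x v : U x -> (forall y, U y -> f y = g y) ->
  cderive f x v = cderive g x v.
Proof. by move=> Ux fg; rewrite !cderiveE; apply: eq_bigr => j _; rewrite (eq_cpart _ Ux fg). Qed.

Lemma csmooth_derivable f x (v : V) : csmooth_on U f -> U x ->
  derivable (fun y => complex.Re (f y)) x v /\
  derivable (fun y => complex.Im (f y)) x v.
Proof. by move=> [fr fi] Ux; split; [exact: (smooth_derivable fr Ux)|exact: (smooth_derivable fi Ux)]. Qed.

Lemma cpart_cst j (c : C) x : cpart j (fun=> c) x = 0.
Proof. by rewrite /cpart !derive_cst. Qed.

Lemma cpart_add j f g x : csmooth_on U f -> csmooth_on U g -> U x ->
  cpart j (fun y => f y + g y) x = cpart j f x + cpart j g x.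
Proof.
move=> sf sg Ux; rewrite /cpart.
have [fr fi] := @csmooth_derivable f x (delta_mx ord0 j) sf Ux.
have [gr gi] := @csmooth_derivable g x (delta_mx ord0 j) sg Ux.
under eq_fun do rewrite ReD; under [X in _ +i* 'D_ _ X _]eq_fun do rewrite ImD.
by rewrite (deriveD fr gr) (deriveD fi gi).
Qed.

Lemma cpart_mul j f g x : csmooth_on U f -> csmooth_on U g -> U x ->
  cpart j (fun y => f y * g y) x = cpart j f x * g x + f x * cpart j g x.
Proof.
move=> sf sg Ux; rewrite /cpart.
have [fr fi] := @csmooth_derivable f x (delta_mx ord0 j) sf Ux.
have [gr gi] := @csmooth_derivable g x (delta_mx ord0 j) sg Ux.
have ->: 'D_(delta_mx ord0 j) (fun y => complex.Re (f y * g y)) x =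
    (complex.Re (f x) * 'D_(delta_mx ord0 j) (fun y => complex.Re (g y)) x +
     complex.Re (g x) * 'D_(delta_mx ord0 j) (fun y => complex.Re (f y)) x) -
    (complex.Im (f x) * 'D_(delta_mx ord0 j) (fun y => complex.Im (g y)) x +
     complex.Im (g x) * 'D_(delta_mx ord0 j) (fun y => complex.Im (f y)) x).
  under eq_fun do rewrite ReM.
  by rewrite (deriveB (derivableM fr gr) (derivableM fi gi)) (deriveM fr gr) (deriveM fi gi).
have ->: 'D_(delta_mx ord0 j) (fun y => complex.Im (f y * g y)) x =
    (complex.Re (f x) * 'D_(delta_mx ord0 j) (fun y => complex.Im (g y)) x +
     complex.Im (g x) * 'D_(delta_mx ord0 j) (fun y => complex.Re (f y)) x) +
    (complex.Im (f x) * 'D_(delta_mx ord0 j) (fun y => complex.Re (g y)) x +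
     complex.Re (g x) * 'D_(delta_mx ord0 j) (fun y => complex.Im (f y)) x).
  under eq_fun do rewrite ImM.
  by rewrite (deriveD (derivableM fr gi) (derivableM fi gr)) (deriveM fr gi) (deriveM fi gr).
move: ('D__ _ x) ('D__ _ x) ('D__ _ x) ('D__ _ x) => a b c d.
case: (f x) (g x) => [p q] [r s]; apply: complex_eqP => /=; ring.
Qed.

Lemma cpart_conj j f x : csmooth_on U f -> U x ->
  cpart j (fun y => (f y)^*) x = (cpart j f x)^*.
Proof.
move=> sf Ux; have [fr fi] := @csmooth_derivable f x (delta_mx ord0 j) sf Ux.
rewrite /cpart; under eq_fun do rewrite Re_conj.
by under [X in _ +i* 'D_ _ X _]eq_fun do rewrite Im_conj; rewrite (deriveN fi).
Qed.

Lemma cpart_comm j k f x : csmooth_on U f -> U x ->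
  cpart j (cpart k f) x = cpart k (cpart j f) x.
Proof.
move=> [fr fi] Ux; rewrite /cpart /=.
by apply: complex_eqP => /=; [exact: (derive_comm _ _ Uo Ux fr)|exact: (derive_comm _ _ Uo Ux fi)].
Qed.

Lemma cderive_cst (c : C) x v : cderive (fun=> c) x v = 0.
Proof. by rewrite cderiveE big1 // => j _; rewrite cpart_cst mulr0. Qed.

Lemma cderive_add f g x v : csmooth_on U f -> csmooth_on U g -> U x ->
  cderive (fun y => f y + g y) x v = cderive f x v + cderive g x v.
Proof.
move=> sf sg Ux; rewrite !cderiveE -big_split /=; apply: eq_bigr => j _.
by rewrite cpart_add // mulrDr.
Qed.

Lemma cderive_mul f g x v : csmooth_on U f -> csmooth_on U g -> U x ->
  cderive (fun y => f y * g y) x v = cderive f x v * g x + f x * cderive g x v.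
Proof.
move=> sf sg Ux; rewrite !cderiveE mulr_suml mulr_sumr -big_split /=.
by apply: eq_bigr => j _; rewrite cpart_mul // mulrDr mulrA mulrCA.
Qed.

Lemma cderive_scale (c : C) f x v : csmooth_on U f -> U x ->
  cderive (fun y => c * f y) x v = c * cderive f x v.
Proof.
move=> sf Ux; rewrite cderive_mul ?cderive_cst ?mul0r ?add0r //; exact: csmooth_cst.
Qed.

Lemma cderive_sum (I : Type) (r : seq I) (P : pred I) (F : I -> V -> C) x v :
  (forall i, csmooth_on U (F i)) -> U x ->
  cderive (fun y => \sum_(i <- r | P i) F i y) x v =
  \sum_(i <- r | P i) cderive (F i) x v.
Proof.
move=> sF Ux; elim: r => [|i r IH].
  by rewrite big_nil; under eq_fun do rewrite big_nil; rewrite cderive_cst.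
rewrite big_cons; under eq_fun do rewrite big_cons; case: (P i) => //.
by rewrite cderive_add ?IH //; exact: csmooth_sum.
Qed.

Lemma cderive_conj f x v : csmooth_on U f -> U x ->
  cderive (fun y => (f y)^*) x (conjv v) = (cderive f x v)^*.
Proof.
move=> sf Ux; rewrite !cderiveE rmorph_sum /=; apply: eq_bigr => j _.
by rewrite cpart_conj // mxE rmorphM.
Qed.

End Domain.
Lemma cderiveD f x v w : cderive f x (v + w) = cderive f x v + cderive f x w.
Proof.
by rewrite !cderiveE -big_split /=; apply: eq_bigr => j _; rewrite mxE mulrDl.
Qed.

Lemma cderiveZ f x (a : C) v : cderive f x (a *: v) = a * cderive f x v.
Proof.
by rewrite !cderiveE mulr_sumr; apply: eq_bigr => j _; rewrite mxE mulrA.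
Qed.

Lemma cderive_split f x v : cderive f x v =
  cderive (fun y => (complex.Re (f y))%:C) x v +
  'i * cderive (fun y => (complex.Im (f y))%:C) x v.
Proof.
rewrite !cderiveE mulr_sumr -big_split /=; apply: eq_bigr => j _.
rewrite /cpart /= derive_cst mulrCA -mulrDr; congr (_ * _).
by move: ('D__ _ x) ('D__ _ x) => a b; apply: complex_eqP => /=; ring.
Qed.

(** Because of this, a dual form that is the differential of a real function is nonzero on a vector
    as soon as the derivative along the conjugate vector is nonzero, so fields of type (0,1) can be
    treated like those of type (1,0). *)
Lemma cderive_real_conj (h : V -> R) x v :
  cderive (fun y => (h y)%:C) x (conjv v) = (cderive (fun y => (h y)%:C) x v)^*.
Proof.
rewrite !cderiveE rmorph_sum /=; apply: eq_bigr => j _.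
by rewrite mxE rmorphM /= /cpart /= derive_cst oppr0.
Qed.

Lemma Re_cderive (h : V -> R) x v : differentiable h x ->
  complex.Re (cderive (fun y => (h y)%:C) x v) =
  'D_(map_mx (@complex.Re R) v) h x.
Proof.
move=> dh; rewrite (row_sum_delta (map_mx _ v)) derive_dir_sum // cderiveE.
rewrite (big_morph _ ReD (erefl : complex.Re (0 : C) = 0)).
apply: eq_bigr => j _.
by rewrite mxE /cpart /= derive_cst ReM /= mulr0 subr0.
Qed.

Lemma Im_cderive (h : V -> R) x v : differentiable h x ->
  complex.Im (cderive (fun y => (h y)%:C) x v) =
  'D_(map_mx (@complex.Im R) v) h x.
Proof.
move=> dh; rewrite (row_sum_delta (map_mx _ v)) derive_dir_sum // cderiveE.
rewrite (big_morph _ ImD (erefl : complex.Im (0 : C) = 0)).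
apply: eq_bigr => j _.
by rewrite mxE /cpart /= derive_cst ImM /= mulr0 add0r.
Qed.

End ComplexCalculus.

(** * Linear algebra *)

Section Subspaces.
Context {R : realType} {n : nat}.
Local Notation CV := (cvec R n).
Local Notation C := (R[i]).
Implicit Types (A B : set CV) (u v w : CV).

Lemma pairingD w u v : pairing w (u + v) = pairing w u + pairing w v.
Proof. by rewrite /pairing -big_split; apply: eq_bigr => j _; rewrite mxE mulrDr. Qed.

Lemma pairingZ w (a : C) v : pairing w (a *: v) = a * pairing w v.
Proof. by rewrite /pairing mulr_sumr; apply: eq_bigr => j _; rewrite mxE mulrCA. Qed.

Lemma pairing0 w : pairing w 0 = 0.
Proof. by rewrite -(scale0r 0) pairingZ mul0r. Qed.

(** Tangent spaces, [H10] and the Levi kernel are given as sets of vectors; their linearity is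
    available before any [{vspace CV}] that represents them. *)
Definition is_subspace A := A 0 /\ forall (a : C) u v, A u -> A v -> A (a *: u + v).

Lemma has_dim_subspace A d : has_dim A d -> is_subspace A.
Proof.
move=> [E [-> _]]; split=> [|a u v /= uE vE]; first exact: mem0v.
by rewrite memvD // memvZ.
Qed.

Lemma subspaceZ A (a : C) u : is_subspace A -> A u -> A (a *: u).
Proof. by move=> [A0 AD] Au; rewrite -[_ *: _]addr0; exact: AD. Qed.

Lemma subspaceI A B : is_subspace A -> is_subspace B -> is_subspace (A `&` B).
Proof. by move=> [A0 AD] [B0 BD]; split=> // a u v [? ?] [? ?]; split; [exact: AD|exact: BD]. Qed.

Lemma subspace_ker w : is_subspace [set v | pairing w v = 0].
Proof.
split=> [|a u v /= u0 v0]; first exact: pairing0.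
by rewrite pairingD pairingZ u0 v0 mulr0 addr0.
Qed.

(** A vector space of largest dimension inside [A] exhausts [A], since adding the line of a missing
    vector would raise the dimension. *)
Lemma has_dim_sub A B d : is_subspace A -> has_dim B d -> A `<=` B ->
  exists2 d', (d' <= d)%N & has_dim A d'.
Proof.
move=> [A0 AD] [E [-> <-]] AE.
pose P (k : nat) := `[< exists F : {vspace CV}, [set v | v \in F] `<=` A /\ \dim F = k >].
have exP : exists k, P k.
  exists 0%N; apply/asboolP; exists 0%VS; split; last exact: dimv0.
  by move=> v /=; rewrite memv0 => /eqP ->.
have ubP k : P k -> (k <= \dim E)%N.
  move=> /asboolP[F [FA <-]]; apply/dimvS/subvP => v vF; exact/AE/FA.
case: (ex_maxnP exP ubP) => k /asboolP[F [FA dF]] kmax.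
exists k; first by apply: ubP; apply/asboolP; exists F.
exists F; split=> //; apply/seteqP; split=> [u Au|]; last exact: FA.
apply: contrapT => uF.
have : P (\dim (F + <[u]>)%VS).
  apply/asboolP; exists (F + <[u]>)%VS; split=> // v /= /memv_addP[a aF [b /vlineP[c ->] ->]].
  by rewrite addrC; apply: AD => //; exact: FA.
move=> /kmax; rewrite leqNgt -dF => /negP; apply.
rewrite ltn_neqAle dimvS ?addvSl // andbT; apply/negP => /eqP FE.
have FF : F = (F + <[u]>)%VS by apply/eqP; rewrite eqEdim addvSl -FE leqnn.
by apply: uF => /=; rewrite FF; apply: (subvP (addvSr _ _)); exact: memv_line.
Qed.

Lemma has_dim_span r (X : 'I_r -> CV) : free [tuple X i | i < r] ->
  has_dim [set v | v \in <<[tuple X i | i < r]>>%VS] r.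
Proof. by move=> fX; exists <<[tuple X i | i < r]>>%VS; split=> //; rewrite (eqnP fX) size_tuple. Qed.

(** Rank-nullity for the pairing with [w], read as a linear map into 1 by 1 matrices. The positivity
    of [d] ensures that [d.-1] is not truncated. *)
Lemma has_dim_ker A d w v : has_dim A d -> A v -> pairing w v != 0 ->
  (0 < d)%N /\ has_dim (A `&` [set u | pairing w u = 0]) d.-1.
Proof.
move=> [E [-> <-]] /= vE wv.
pose f : 'Hom(CV, 'M[C]_1) := linfun (mulmxr w^T).
have fE u : f u = (pairing w u)%:M.
  rewrite lfunE /=; apply/matrixP => i j; rewrite !ord1 !mxE mulr1n.
  by apply: eq_bigr => k _; rewrite mxE mulrC.
have f0 u : (f u == 0) = (pairing w u == 0).
  rewrite fE; apply/eqP/eqP => [|->]; last by rewrite raddf0.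
  by move/matrixP/(_ ord0 ord0); rewrite !mxE mulr1n.
have df : \dim (f @: E) = 1%N.
  apply/eqP; rewrite eqn_leq; apply/andP; split.
    by rewrite (leq_trans (dimvS (subvf _))) // dimvf.
  rewrite lt0n dimv_eq0; apply/eqP => fE0.
  have : f v \in (f @: E)%VS by exact: memv_img.
  by rewrite fE0 memv0 f0 (negbTE wv).
have := limg_ker_dim f E; rewrite df addn1 => dE.
split; first by rewrite -dE.
exists (E :&: lker f)%VS; split; last by rewrite -dE.
apply/seteqP; split=> u /=; rewrite memv_cap memv_ker f0.
  by move=> [-> ->]; rewrite eqxx.
by move=> /andP[-> /eqP].
Qed.

Lemma free_tupleP r (X : 'I_r -> CV) : free [tuple X i | i < r] <->
  forall k : 'I_r -> C, \sum_i k i *: X i = 0 -> forall i, k i = 0.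
Proof.
split=> [/freeP + k k0|H]; last apply/freeP => k; last (move=> k0; apply: H).
  by apply; rewrite -[RHS]k0; apply: eq_bigr => i _; rewrite -tnth_nth tnth_mktuple.
by rewrite -[RHS]k0; apply: eq_bigr => i _; rewrite -tnth_nth tnth_mktuple.
Qed.

(** Elimination of [X i0] in cleared form: the coefficients of [Y] are values of [w] without any
    division, so the same formula yields smooth fields when [X] and [w] vary smoothly. *)
Lemma span_ker_frame r (X : 'I_r.+1 -> CV) (i0 : 'I_r.+1) w :
  free [tuple X i | i < r.+1] -> pairing w (X i0) != 0 ->
  let Y (k : 'I_r) := pairing w (X i0) *: X (lift i0 k) -
             pairing w (X (lift i0 k)) *: X i0 in
  free [tuple Y k | k < r] /\
  [set v | v \in <<[tuple X i | i < r.+1]>>%VS] `&` [set v | pairing w v = 0] =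
  [set v | v \in <<[tuple Y k | k < r]>>%VS].
Proof.
move=> fX c0 Y.
have fY : free [tuple Y k | k < r].
  apply/free_tupleP => k k0 i; move/free_tupleP: (fX) => H.
  (* These are the coefficients of the combination of the [Y] in terms of the [X]. *)
  pose k' (j : 'I_r.+1) : C := if unlift i0 j is Some j' then k j' * pairing w (X i0)
    else - \sum_l k l * pairing w (X (lift i0 l)).
  have : \sum_j k' j *: X j = 0.
    rewrite (bigD1_ord i0) //= /k' unlift_none -[RHS]k0.
    under eq_bigr do rewrite liftK.
    rewrite scaleNr scaler_suml -sumrN -big_split /=; apply: eq_bigr => l _.
    by rewrite /Y scalerBr !scalerA addrC.
  move=> /H/(_ (lift i0 i)); rewrite /k' liftK => /eqP.
  by rewrite mulf_eq0 (negbTE c0) orbF => /eqP.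
split=> //.
have X0 : [set v | v \in <<[tuple X i | i < r.+1]>>%VS] (X i0).
  by apply: memv_span; apply/tnthP; exists i0; rewrite tnth_mktuple.
have [_ [E [EE dE]]] := has_dim_ker (has_dim_span fX) X0 c0.
rewrite EE; suff -> : E = <<[tuple Y k | k < r]>>%VS by [].
apply/esym/eqP; rewrite eqEdim dE /= (eqnP fY) size_tuple leqnn andbT.
apply/span_subvP => v /mapP[k _ ->].
suff : [set` E] (Y k) by [].
rewrite -EE; split=> /=; last first.
  by rewrite /Y -scaleNr pairingD !pairingZ mulNr mulrC subrr.
have XS i : X i \in <<[tuple X i | i < r.+1]>>%VS.
  by apply: memv_span; apply/tnthP; exists i; rewrite tnth_mktuple.
by rewrite /Y memvB // memvZ.
Qed.

End Subspaces.

(** * Vector fields and brackets *)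

Section Fields.
Context {R : realType} {n : nat}.
Local Notation V := (pt R n).
Local Notation CV := (cvec R n).
Local Notation C := (R[i]).
Local Notation field := (V -> CV).
Implicit Types (S U : set V) (f g : V -> C) (u v w : CV) (x : V) (X Y Z : field).

(** The flat derivative D_v X; the bracket becomes D_X Y - D_Y X. *)
Definition dirder X x v : CV := \row_j cderive (fun y => X y ord0 j) x v.

Lemma bracketE X Y x : bracket X Y x = dirder Y x (X x) - dirder X x (Y x).
Proof. by apply/rowP => j; rewrite !mxE. Qed.

Lemma sub_smooth_field U U' X : U' `<=` U -> smooth_field_on U X -> smooth_field_on U' X.
Proof. by move=> sU sX j; have [sr si] := sX j; split; exact: sub_smooth_on sU _. Qed.

Lemma conjv_lin (a : C) u v : conjv (a *: u + v) = conjc a *: conjv u + conjv v.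
Proof. by apply/rowP => j; rewrite !mxE rmorphD rmorphM. Qed.

Lemma conjvK : involutive (@conjv R n).
Proof. by move=> v; apply/rowP => j; rewrite !mxE conjcK. Qed.

Lemma conjfK : involutive (@conjf R n).
Proof. by move=> X; apply/funext => x; exact: conjvK. Qed.

Lemma conjv0 : conjv (0 : CV) = 0.
Proof. by apply/rowP => j; rewrite !mxE rmorph0. Qed.

Section Domain.
Variables (U : set V) (Uo : open U).

Lemma smooth_field_conj X : smooth_field_on U X -> smooth_field_on U (conjf X).
Proof.
move=> sX j; under eq_fun do rewrite /conjf /conjv mxE.
by apply: csmooth_conj.
Qed.

Lemma smooth_field_cst v : smooth_field_on U (fun=> v).
Proof. by move=> j; exact: csmooth_cst. Qed.

Lemma smooth_field_add X Y : smooth_field_on U X -> smooth_field_on U Y ->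
  smooth_field_on U (fun x => X x + Y x).
Proof. by move=> sX sY j; under eq_fun do rewrite mxE; exact: csmooth_add. Qed.

Lemma smooth_field_scale f X : csmooth_on U f -> smooth_field_on U X ->
  smooth_field_on U (fun x => f x *: X x).
Proof. by move=> sf sX j; under eq_fun do rewrite mxE; exact: csmooth_mul. Qed.

Lemma smooth_field_sum (I : Type) (r : seq I) (P : pred I) (F : I -> field) :
  (forall i, smooth_field_on U (F i)) ->
  smooth_field_on U (fun x => \sum_(i <- r | P i) F i x).
Proof.
move=> sF j; under eq_fun do rewrite summxE.
by apply: csmooth_sum => // i _; exact: sF.
Qed.

Lemma smooth_field_bracket X Y : smooth_field_on U X -> smooth_field_on U Y ->
  smooth_field_on U (bracket X Y).
Proof.
move=> sX sY j; under eq_fun do rewrite /bracket mxE.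
apply: csmooth_add => //; first exact: csmooth_cderive.
by apply: csmooth_opp => //; exact: csmooth_cderive.
Qed.

Lemma csmooth_pairing X Y : smooth_field_on U X -> smooth_field_on U Y ->
  csmooth_on U (fun x => pairing (X x) (Y x)).
Proof. by move=> sX sY; apply: csmooth_sum => // j _; exact: csmooth_mul. Qed.

Lemma cderive_pairing X Y x v : smooth_field_on U X -> smooth_field_on U Y -> U x ->
  cderive (fun y => pairing (X y) (Y y)) x v =
  pairing (dirder X x v) (Y x) + pairing (X x) (dirder Y x v).
Proof.
move=> sX sY Ux; rewrite (cderive_sum Uo) //; last by move=> j; exact: csmooth_mul.
rewrite /pairing -big_split /=; apply: eq_bigr => j _.
by rewrite (@cderive_mul _ _ U) // /dirder [in RHS]mxE [X in _ = _ + _ * X]mxE.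
Qed.

(** Both iterated derivatives contain the complex-bilinear Hessian [Q] of [f], which is symmetric
    and cancels; what remains is the derivative of [f] along D_X Y - D_Y X. *)
Lemma cderive_bracket f X Y x : csmooth_on U f ->
  smooth_field_on U X -> smooth_field_on U Y -> U x ->
  cderive f x (bracket X Y x) =
  cderive (lie_derive Y f) x (X x) - cderive (lie_derive X f) x (Y x).
Proof.
move=> sf sX sY Ux.
pose Q u v := \sum_j \sum_k u ord0 j * v ord0 k * cpart k (cpart j f) x.
have Qsym u v : Q u v = Q v u.
  rewrite /Q exchange_big /=; apply: eq_bigr => j _; apply: eq_bigr => k _.
  by rewrite (cpart_comm Uo _ _ sf Ux) (mulrC (u ord0 k)).
have lieE Z v : smooth_field_on U Z ->
    cderive (lie_derive Z f) x v = cderive f x (dirder Z x v) + Q (Z x) v.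
  move=> sZ; rewrite /lie_derive (cderive_sum Uo) //; last first.
    by move=> j; apply: csmooth_mul => //; exact: csmooth_cpart.
  rewrite [X in X + _]cderiveE /Q -big_split /=; apply: eq_bigr => j _.
  rewrite (@cderive_mul _ _ U) //; last exact: csmooth_cpart.
  rewrite /dirder [in RHS]mxE; congr (_ + _).
  rewrite cderiveE mulr_sumr; apply: eq_bigr => k _.
  by rewrite mulrA.
rewrite (lieE _ _ sX) (lieE _ _ sY) Qsym bracketE -scaleN1r cderiveD cderiveZ mulN1r.
move: (Q _ _) (cderive _ _ _) (cderive _ _ _) => a b c.
by rewrite opprD addrACA subrr addr0.
Qed.

End Domain.

Lemma CT_conj S x v : CT S x v -> CT S x (conjv v).
Proof. by move=> vT U g Uo Ux sg g0; rewrite cderive_real_conj (vT U g) // rmorph0. Qed.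

Lemma CT_subspace S x : is_subspace (CT S x).
Proof.
split=> [U g *|a u v uT vT U g Uo Ux sg g0].
  by rewrite -(scale0r 0) cderiveZ mul0r.
by rewrite cderiveD cderiveZ (uT U g) // (vT U g) // mulr0 addr0.
Qed.

Lemma type10P v : type10 v <->
  forall k, v ord0 (lshift n k) = 'i * v ord0 (rshift n k).
Proof.
split=> [/matrixP vT k|vT]; first by have := vT ord0 k; rewrite !mxE.
by apply/matrixP => i k; rewrite ord1 !mxE vT.
Qed.

Lemma type10_subspace : is_subspace (@type10 R n).
Proof.
split=> [|a u v /type10P uT /type10P vT]; apply/type10P => k; rewrite !mxE ?mulr0 //.
by rewrite uT vT mulrDr mulrCA.
Qed.

Lemma H10_subspace S x : is_subspace (H10 S x).
Proof. by apply: subspaceI; [exact: CT_subspace|exact: type10_subspace]. Qed.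

Lemma CT_cderive S U x g v : open U -> U x -> csmooth_on U g ->
  (forall y, U y -> S y -> g y = 0) -> CT S x v -> cderive g x v = 0.
Proof.
move=> Uo Ux [gr gi] g0 vT; rewrite cderive_split.
by rewrite (vT U) ?(vT U) ?mulr0 ?addr0 // => y Sy Uy; rewrite g0.
Qed.

Lemma H10_CH S x v : H10 S x v -> CH S x v.
Proof.
move=> vH; exists v, 0; split=> //; last by rewrite conjv0 addr0.
by have [] := H10_subspace S x.
Qed.

Lemma conjH10_CH S x v : H10 S x v -> CH S x (conjv v).
Proof.
move=> vH; exists 0, v; split=> //; last by rewrite add0r.
by have [] := H10_subspace S x.
Qed.

Lemma CH_subspace S x : is_subspace (CH S x).
Proof.
have [H0 HD] := H10_subspace S x.
split=> [|a u v [u1 [u2 [u1H u2H ->]]] [v1 [v2 [v1H v2H ->]]]].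
  by exists 0, 0; split=> //; rewrite conjv0 addr0.
exists (a *: u1 + v1), (conjc a *: u2 + v2); split; [exact: HD|exact: HD|].
by rewrite conjv_lin conjcK scalerDr addrACA.
Qed.

Lemma CH_CT S x v : CH S x v -> CT S x v.
Proof.
have [_ TD] := CT_subspace S x.
move=> [a [b [[aT _] [bT _] ->]]].
by rewrite -[a]scale1r; apply: TD => //; exact: CT_conj.
Qed.

(* The value at [x] of the 1-form [- d theta(., Y)]. *)
Definition contraction (theta Y : field) x : CV :=
  \row_k \sum_j (cpart j (fun y => theta y ord0 k) x -
                 cpart k (fun y => theta y ord0 j) x) * Y x ord0 j.

Lemma smooth_contraction U (theta Y : field) : open U ->
  smooth_field_on U theta -> smooth_field_on U Y ->
  smooth_field_on U (contraction theta Y).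
Proof.
move=> Uo st sY k; under eq_fun do rewrite mxE.
apply: csmooth_sum => // j _; apply: csmooth_mul => //; apply: csmooth_add => //.
  exact: csmooth_cpart.
by apply: csmooth_opp => //; exact: csmooth_cpart.
Qed.

(** Cartan's formula d theta(X, Y) = X theta(Y) - Y theta(X) - theta([X, Y]): the first two terms
    vanish, being tangential derivatives of functions that are zero on [S]. The right side depends
    on [X] only through its value at [x]. *)
Lemma form_bracket S U (theta X Y : field) x : open U -> U x ->
  smooth_field_on U theta -> smooth_field_on U X -> smooth_field_on U Y ->
  (forall y, U y -> S y -> form_app theta X y = 0) ->
  (forall y, U y -> S y -> form_app theta Y y = 0) ->
  CT S x (X x) -> CT S x (Y x) ->
  form_app theta (bracket X Y) x = pairing (contraction theta Y x) (X x).
Proof.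
move=> Uo Ux st sX sY X0 Y0 XT YT.
have eX : cderive (form_app theta Y) x (X x) = 0.
  by apply: (CT_cderive Uo Ux _ Y0 XT); exact: csmooth_pairing.
have eY : cderive (form_app theta X) x (Y x) = 0.
  by apply: (CT_cderive Uo Ux _ X0 YT); exact: csmooth_pairing.
have -> : form_app theta (bracket X Y) x =
    pairing (dirder theta x (Y x)) (X x) - pairing (dirder theta x (X x)) (Y x).
  rewrite /form_app bracketE -scaleN1r pairingD pairingZ mulN1r.
  move: eX eY; rewrite /form_app !(cderive_pairing Uo) // => /eqP + /eqP.
  by rewrite !addr_eq0 => /eqP -> /eqP ->; rewrite opprK addrC.
rewrite {1 2}/pairing /dirder.
have -> : \sum_j (\row_j0 cderive (fun y => theta y ord0 j0) x (X x)) ord0 j * Y x ord0 j =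
   \sum_k \sum_j X x ord0 k * cpart k (fun y => theta y ord0 j) x * Y x ord0 j.
  rewrite exchange_big /=; apply: eq_bigr => j _.
  by rewrite mxE cderiveE mulr_suml.
rewrite -sumrB; apply: eq_bigr => k _; rewrite !mxE cderiveE.
rewrite !mulr_suml -sumrB; apply: eq_bigr => j _.
move: (cpart j _ x) (cpart k _ x) (X x ord0 k) (Y x ord0 j) => a b c d; ring.
Qed.

End Fields.

(** * Real hypersurfaces *)

Section Hypersurface.
Context {R : realType} {n : nat}.
Local Notation V := (pt R n).
Local Notation CV := (cvec R n).
Local Notation C := (R[i]).
Local Notation field := (V -> CV).
Implicit Types (S U M : set V) (u v w : CV) (x : V) (X Y Z : field).

(** The real and imaginary parts of a vector killed by the differentials of the [F j] are themselves
    killed by them, so [derive_eq0_on_zeros] applies to each part. Finitely many equations thus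
    replace the test against all functions vanishing on [M]. *)
Lemma CT_zeros c U M (F : 'I_c -> V -> R) x :
  open U -> U x -> (forall j, smooth_on U (F j)) ->
  (forall y, U y -> (M y <-> forall j, F j y = 0)) -> M x ->
  (forall u : 'I_c -> R, exists v : V, forall j, 'D_v (F j) x = u j) ->
  CT M x = [set v | forall j, cderive (fun y => (F j y)%:C) x v = 0].
Proof.
move=> Uo Ux sF MF Mx surF.
apply/seteqP; split=> [v vT j|v v0 U' g U'o U'x sg g0].
  by apply: (vT U) => // y My Uy; exact: (MF y Uy).1.
have dg : differentiable g x := smooth_differentiable sg U'x.
have Fx := (MF x Ux).1 Mx.
have gz (w : V) : (forall j, 'D_w (F j) x = 0) -> 'D_w g x = 0.
  apply: (@derive_eq0_on_zeros _ _ _ (U `&` U') F) => //; first exact: openI.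
    by move=> j; apply: sub_smooth_on (sF j) => y [].
  by move=> y [Uy U'y] Fy; apply: g0 => //; exact: (MF y Uy).2.
have dF j : differentiable (F j) x := smooth_differentiable (sF j) Ux.
apply: complex_eqP.
  by rewrite Re_cderive // gz // => j; rewrite -Re_cderive // v0.
by rewrite Im_cderive // gz // => j; rewrite -Im_cderive // v0.
Qed.

(** This keeps of a smooth boundary only that it is locally a regular level set; the sides of the
    hypersurface are forgotten. *)
Definition local_equation S U (rho : V -> R) :=
  [/\ open U, smooth_on U rho, forall x, U x -> exists v : V, 'D_v rho x != 0 &
      forall x, U x -> (S x <-> rho x = 0)].

Lemma local_equationS S U U' rho : open U' -> U' `<=` U ->
  local_equation S U rho -> local_equation S U' rho.
Proof.
move=> U'o sU [Uo sr dr Sr]; split=> //.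
- exact: sub_smooth_on sr.
- by move=> x /sU; exact: dr.
- by move=> x /sU; exact: Sr.
Qed.

(** The basis vectors are i d/dx_k + d/dy_k, that is, 2i times d/dz_k. In this normalization the
    y-half of a vector gives its coordinates. *)
Lemma exists_type10_basis : exists X : 'I_n -> CV,
  [/\ free [tuple X i | i < n],
      @type10 R n = [set v | v \in <<[tuple X i | i < n]>>%VS] &
      forall i j, X i ord0 (rshift n j) = (i == j)%:R].
Proof.
pose X (i : 'I_n) : CV := row_mx ('i *: delta_mx ord0 i) (delta_mx ord0 i).
have Xr i j : X i ord0 (rshift n j) = (i == j)%:R by rewrite row_mxEr mxE eqxx eq_sym.
have Xl i j : X i ord0 (lshift n j) = 'i * (i == j)%:R.
  by rewrite row_mxEl mxE mxE eqxx eq_sym.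
exists X; split=> //.
  apply/free_tupleP => k k0 i; move/rowP/(_ (rshift n i)): k0.
  rewrite mxE summxE (bigD1 i) //= mxE Xr eqxx mulr1 big1 ?addr0 //.
  by move=> j ji; rewrite mxE Xr (negbTE ji) mulr0.
apply/seteqP; split=> v /=.
  move=> /type10P vT.
  have -> : v = \sum_i v ord0 (rshift n i) *: X i.
    apply/rowP => j; rewrite summxE -(splitK j); case: (fintype.split j) => k /=.
      rewrite vT (bigD1 k) //= big1 ?addr0 => [|i ik]; last first.
        by rewrite mxE Xl (negbTE ik) !mulr0.
      by rewrite mxE Xl eqxx mulr1 mulrC.
    rewrite (bigD1 k) //= big1 ?addr0 => [|i ik]; last first.
      by rewrite mxE Xr (negbTE ik) mulr0.
    by rewrite mxE Xr eqxx mulr1.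
  apply: rpred_sum => i _; apply: rpredZ; apply: memv_span.
  by apply/mapP; exists i; rewrite ?mem_enum.
move=> vS; have [T0 TD] := @type10_subspace R n.
suff : (v \in <<[tuple X i | i < n]>>%VS) -> type10 v by apply.
move=> /coord_span ->; apply: (big_ind (@type10 R n)) => //.
  by move=> a b aT bT; rewrite -[a]scale1r; exact: TD.
move=> i _; apply: subspaceZ; first exact: type10_subspace.
rewrite -tnth_nth tnth_mktuple; apply/type10P => k; by rewrite Xl Xr.
Qed.

Section LocalEquation.
Variables (S U : set V) (rho : V -> R) (eqS : local_equation S U rho).
Let Uo : open U. Proof. by case: eqS. Qed.
Let srho : smooth_on U rho. Proof. by case: eqS. Qed.

Definition gradient x : CV := \row_j cpart j (fun y => (rho y)%:C) x.

Lemma gradientE x v : cderive (fun y => (rho y)%:C) x v = pairing (gradient x) v.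
Proof. by rewrite cderiveE; apply: eq_bigr => j _; rewrite mxE mulrC. Qed.

Lemma csmooth_rho : csmooth_on U (fun y => (rho y)%:C).
Proof. exact: csmooth_real. Qed.

Lemma CT_hypersurface x : U x -> S x -> CT S x = [set v | pairing (gradient x) v = 0].
Proof.
move=> Ux Sx; have [_ _ dr Sr] := eqS.
rewrite (@CT_zeros 1 U S (fun=> rho) x) //.
- apply/seteqP; split=> v /=; first by move=> /(_ ord0); rewrite gradientE.
  by move=> v0 _; rewrite gradientE.
- by move=> y Uy; rewrite Sr //; split=> // /(_ ord0).
move=> u; have [v v0] := dr x Ux.
exists ((u ord0 / 'D_v rho x) *: v) => j.
have drho : differentiable rho x := smooth_differentiable srho Ux.
by rewrite derive_dirZ // divfK // (ord1 j).
Qed.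

Lemma CT_eq0 x v : U x -> S x -> CT S x v -> pairing (gradient x) v = 0.
Proof. by move=> Ux Sx; rewrite CT_hypersurface. Qed.

(** The differential of [rho] is nonzero on some d/dz_k: since [rho] is real, the equation i
    rho_(x_k) + rho_(y_k) = 0 forces both partial derivatives to vanish. It therefore cuts the
    n-dimensional space [type10] in a hyperplane. *)
Lemma H10_dim x : U x -> S x -> has_dim (H10 S x) n.-1.
Proof.
move=> Ux Sx; have [_ _ dr _] := eqS; have [v v0] := dr x Ux.
have [X [fX XT Xr]] := exists_type10_basis.
have drho : differentiable rho x := smooth_differentiable srho Ux.
have Xl i j : X i ord0 (lshift n j) = 'i * (i == j)%:R.
  have /type10P -> : type10 (X i); last by rewrite Xr.
  by rewrite XT; apply: memv_span; apply/mapP; exists i; rewrite ?mem_enum.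
have [k Xk] : exists k, pairing (gradient x) (X k) != 0.
  apply: contrapT => nX; move/eqP: v0; apply.
  have pX k : pairing (gradient x) (X k) = 0.
    by apply/eqP; apply: contrapT => /negP kX; apply: nX; exists k.
  have gX k : pairing (gradient x) (X k) =
      'i * gradient x ord0 (lshift n k) + gradient x ord0 (rshift n k).
    rewrite /pairing big_split_ord /= (bigD1 k) //= big1 ?addr0 => [|i ik]; last first.
      by rewrite Xl eq_sym (negbTE ik) !mulr0.
    rewrite Xl eqxx mulr1 (bigD1 k) //= big1 ?addr0 => [|i ik]; last first.
      by rewrite Xr eq_sym (negbTE ik) mulr0.
    by rewrite Xr eqxx mulr1 mulrC.
  have i_real_eq0 (a b : R) : 0 = 'i * (a +i* 0) + (b +i* 0) :> C -> a = 0 /\ b = 0.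
    by move=> [E1 E2]; split; lra.
  have gradE j : gradient x ord0 j = 'D_(delta_mx ord0 j) rho x +i* 0.
    by rewrite mxE /cpart /= derive_cst.
  have D0 k : 'D_(delta_mx ord0 (lshift n k)) rho x = 0 /\
              'D_(delta_mx ord0 (rshift n k)) rho x = 0.
    apply: i_real_eq0; have := gX k; rewrite pX => ->.
    by rewrite !gradE.
  rewrite (row_sum_delta v) derive_dir_sum // big_split_ord /= !big1 ?addr0 // => i _;
    by have [Dl Dr] := D0 i; rewrite ?Dl ?Dr mulr0.
have Tn : has_dim (@type10 R n) n by rewrite XT; exact: has_dim_span.
have XkT : type10 (X k).
  by rewrite XT; apply: memv_span; apply/mapP; exists k; rewrite ?mem_enum.
have [_] := has_dim_ker Tn XkT Xk.
by rewrite /H10 CT_hypersurface // setIC.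
Qed.

(** Type (1,0) is expressed by linear equations with constant coefficients. They hold for [X] along
    [S], so they can be differentiated in tangential directions. *)
Lemma dirder_type10 X x v : smooth_field_on U X -> U x -> S x ->
  (forall y, U y -> S y -> type10 (X y)) -> CT S x v -> type10 (dirder X x v).
Proof.
move=> sX Ux Sx XT vT; apply/type10P => k; rewrite !mxE.
apply/eqP; rewrite -subr_eq0 -mulN1r; apply/eqP.
rewrite -(@cderive_scale _ _ U 'i) // -(@cderive_scale _ _ U (-1)) //; last first.
  by apply: csmooth_mul => //; exact: csmooth_cst.
rewrite -(@cderive_add _ _ U) //; last first.
  by do 2 (apply: csmooth_mul => //; first exact: csmooth_cst).
apply: (CT_cderive Uo Ux) vT.
  apply: csmooth_add => //.
  by do 2 (apply: csmooth_mul => //; first exact: csmooth_cst).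
by move=> y Uy Sy; rewrite (type10P _).1 ?mulN1r ?subrr //; exact: XT.
Qed.

Definition tangent X := forall y, U y -> S y -> CT S y (X y).

Lemma lie_derive_rho X : tangent X ->
  forall y, U y -> S y -> lie_derive X (fun y => (rho y)%:C) y = 0.
Proof. by move=> XT y Uy Sy; rewrite /lie_derive gradientE CT_eq0 //; exact: XT. Qed.

(** Apply [cderive_bracket] to [rho]: the functions X rho and Y rho vanish on [S], hence so do their
    tangential derivatives. *)
Lemma bracket_CT X Y x : smooth_field_on U X -> smooth_field_on U Y -> U x -> S x ->
  tangent X -> tangent Y -> CT S x (bracket X Y x).
Proof.
move=> sX sY Ux Sx XT YT; rewrite CT_hypersurface //= -gradientE.
rewrite (cderive_bracket Uo csmooth_rho) // !(CT_cderive Uo Ux _ (lie_derive_rho _)) ?subrr //.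
- exact: (csmooth_cderive Uo csmooth_rho sX).
- exact: YT.
- exact: (csmooth_cderive Uo csmooth_rho sY).
- exact: XT.
Qed.

Lemma section_tangent X : section S U (H10 S) X -> tangent X.
Proof. by move=> [_ XH] y Uy Sy; have [] := XH y Uy Sy. Qed.

Lemma section_conj_tangent X : section S U (H10 S) X -> tangent (conjf X).
Proof. by move=> [_ XH] y Uy Sy; have [/CT_conj] := XH y Uy Sy. Qed.

(** The integrability of the CR structure of [S]: in D_X Y - D_Y X both terms have type (1,0). *)
Lemma bracket_H10 X Y x : section S U (H10 S) X -> section S U (H10 S) Y ->
  U x -> S x -> H10 S x (bracket X Y x).
Proof.
move=> sX sY Ux Sx; have XT := section_tangent sX; have YT := section_tangent sY.
have [smX XH] := sX; have [smY YH] := sY.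
split; first exact: bracket_CT.
rewrite bracketE -scaleN1r addrC; have [_] := @type10_subspace R n; apply.
  apply: dirder_type10 => // [y Uy Sy|]; first by have [] := XH y Uy Sy.
  exact: YT.
apply: dirder_type10 => // [y Uy Sy|]; first by have [] := YH y Uy Sy.
exact: XT.
Qed.

(** When [X] vanishes at [x], only - D_Y X survives, and this has type (1,0) whatever the type of
    [Y]. In this way the Levi form depends on [X] through its value alone. *)
Lemma bracket_zero_H10 X Y x : section S U (H10 S) X -> smooth_field_on U Y ->
  tangent Y -> U x -> S x -> X x = 0 -> H10 S x (bracket X Y x).
Proof.
move=> sX smY YT Ux Sx X0; have XT := section_tangent sX; have [smX XH] := sX.
split; first exact: bracket_CT.
rewrite bracketE X0 -scaleN1r addrC; have [_] := @type10_subspace R n; apply.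
  apply: dirder_type10 => // [y Uy Sy|]; first by have [] := XH y Uy Sy.
  exact: YT.
apply/type10P => k; rewrite !mxE -(scale0r 0) !cderiveZ.
by rewrite !mul0r mulr0.
Qed.

End LocalEquation.
End Hypersurface.

(** * Dual forms *)

Section DualForms.
Context {R : realType} {n : nat}.
Local Notation V := (pt R n).
Local Notation CV := (cvec R n).
Local Notation C := (R[i]).
Local Notation field := (V -> CV).
Implicit Types (S U : set V) (u v w : CV) (x : V) (X Y L : field) (E : V -> set CV).
Implicit Types (l : seq field) (theta : field).

Definition either_section S U E X := section S U E X \/ conj_section S U E X.

Definition all_sections S U E l :=
  forall i, (i < size l)%N -> either_section S U E (nth (fun=> 0) l i).

Lemma all_sections_cons S U E X l :
  all_sections S U E (X :: l) <-> either_section S U E X /\ all_sections S U E l.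
Proof.
split=> [H|[H1 H2] [|i] //]; last by move=> il; exact: H2.
by split=> [|i il]; [exact: (H 0%N)|exact: (H i.+1)].
Qed.

Lemma all_sections_rcons S U E X l :
  all_sections S U E (rcons l X) <-> either_section S U E X /\ all_sections S U E l.
Proof.
split=> [H|[HX Hl] i].
  split=> [|i il]; first by have := H (size l); rewrite size_rcons nth_rcons ltnn eqxx; apply.
  by have := H i; rewrite size_rcons nth_rcons il; apply; exact: ltnW.
rewrite size_rcons nth_rcons ltnS leq_eqVlt; case: ltnP => [il _|_]; first exact: Hl.
by rewrite orbF => ->.
Qed.

Lemma section_smooth S U E X : section S U E X -> smooth_field_on U X.
Proof. by case. Qed.

Lemma either_section_smooth S U E X : open U -> either_section S U E X -> smooth_field_on U X.
Proof. by move=> Uo [|] [] // sX _; rewrite -[X]conjfK; exact: smooth_field_conj. Qed.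

Lemma sub_section S U U' E X : U' `<=` U -> section S U E X -> section S U' E X.
Proof.
move=> sU [sX XE]; split; first exact: sub_smooth_field sX.
by move=> y /sU Uy Sy; exact: XE.
Qed.

Lemma sub_either_section S U U' E X : U' `<=` U ->
  either_section S U E X -> either_section S U' E X.
Proof. by move=> sU [] sX; [left|right]; exact: sub_section sX. Qed.

Lemma section_weaken S U E E' X : (forall x, U x -> S x -> E x `<=` E' x) ->
  section S U E X -> section S U E' X.
Proof. by move=> EE' [sX XE]; split=> // y Uy Sy; apply: EE' => //; exact: XE. Qed.

Lemma either_section_weaken S U E E' X : (forall x, U x -> S x -> E x `<=` E' x) ->
  either_section S U E X -> either_section S U E' X.
Proof. by move=> EE' [] sX; [left|right]; exact: section_weaken sX. Qed.

Lemma sub_all_sections S U U' E l : U' `<=` U -> all_sections S U E l -> all_sections S U' E l.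
Proof. by move=> sU H i il; apply: sub_either_section sU _; exact: H. Qed.

Lemma all_sections_weaken S U E E' l : (forall x, U x -> S x -> E x `<=` E' x) ->
  all_sections S U E l -> all_sections S U E' l.
Proof. by move=> EE' H i il; apply: either_section_weaken EE' _; exact: H. Qed.

Lemma either_section_scale S U E (c : C) X : open U ->
  (forall x, U x -> S x -> is_subspace (E x)) ->
  either_section S U E X -> either_section S U E (fun y => c *: X y).
Proof.
move=> Uo subE [] [sX XE]; [left|right]; (split; last move=> y Uy Sy).
- exact: (smooth_field_scale Uo (csmooth_cst U c) sX).
- by apply: subspaceZ; [exact: subE|exact: XE].
- have -> : conjf (fun y => c *: X y) = (fun y => conjc c *: conjf X y).
    by apply/funext => y; rewrite /conjf -[c *: _]addr0 conjv_lin conjv0 addr0.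
  exact: (smooth_field_scale Uo (csmooth_cst U _) sX).
- rewrite /conjf -[c *: _]addr0 conjv_lin conjv0 addr0.
  by apply: subspaceZ; [exact: subE|exact: XE].
Qed.

Definition fold_lie (g : V -> C) l := foldl (fun g X => lie_derive X g) g l.

Lemma csmooth_fold_lie U g l : open U -> csmooth_on U g ->
  (forall i, (i < size l)%N -> smooth_field_on U (nth (fun=> 0) l i)) ->
  csmooth_on U (fold_lie g l).
Proof.
move=> Uo; rewrite /fold_lie; elim: l g => [//|X l IH] g sg sl /=; apply: IH.
  by apply: csmooth_cderive => //; exact: (sl 0%N).
by move=> i il; exact: (sl i.+1).
Qed.

Lemma fold_lie_scale U g g' (c : C) l : open U -> csmooth_on U g ->
  (forall i, (i < size l)%N -> smooth_field_on U (nth (fun=> 0) l i)) ->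
  (forall y, U y -> g' y = c * g y) ->
  forall y, U y -> fold_lie g' l y = c * fold_lie g l y.
Proof.
move=> Uo; rewrite /fold_lie; elim: l g g' => [//|X l IH] g g' sg sl gg' /=; apply: IH.
- by apply: csmooth_cderive => //; exact: (sl 0%N).
- by move=> i il; exact: (sl i.+1).
move=> y Uy; rewrite /lie_derive (eq_cderive Uo _ Uy gg').
by rewrite (@cderive_scale _ _ U).
Qed.

Lemma conjvB u v : conjv (u - v) = conjv u - conjv v.
Proof. by apply/rowP => j; rewrite !mxE rmorphB. Qed.

Lemma bracket_conj U X Y x : smooth_field_on U X -> smooth_field_on U Y -> U x ->
  bracket (conjf X) (conjf Y) x = conjv (bracket X Y x).
Proof.
move=> sX sY Ux.
have dc Z v : smooth_field_on U Z -> dirder (conjf Z) x (conjv v) = conjv (dirder Z x v).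
  move=> sZ; apply/rowP => j; rewrite [LHS]mxE [RHS]mxE [in RHS]mxE.
  have -> : (fun y => conjf Z y ord0 j) = (fun y => conjc (Z y ord0 j)).
    by apply/funext => y; rewrite /conjf mxE.
  exact: (cderive_conj v (sZ j) Ux).
by rewrite !bracketE !dc // conjvB.
Qed.

Lemma bracket_scale U X Y (c : C) x : smooth_field_on U Y -> U x ->
  bracket X (fun y => c *: Y y) x = c *: bracket X Y x.
Proof.
move=> sY Ux; rewrite !bracketE scalerBr; congr (_ - _); apply/rowP => j.
  rewrite [LHS]mxE [RHS]mxE [X in _ = _ * X]mxE.
  have -> : (fun y => (c *: Y y) ord0 j) = (fun y => c * Y y ord0 j).
    by apply/funext => y; rewrite mxE.
  exact: (cderive_scale c (X x) (sY j) Ux).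
by rewrite [LHS]mxE [RHS]mxE [X in _ = _ * X]mxE cderiveZ.
Qed.

Lemma bracket_anti X Y x : bracket X Y x = - bracket Y X x.
Proof. by rewrite !bracketE opprB. Qed.

(* The coefficients of the dual form, extended to all tangent vectors. *)
Definition dual_covector theta l x : CV :=
  match l with
  | [::] => 0
  | [:: L1] => contraction theta L1 x
  | [:: L1, L2 & l'] => \row_j cpart j (fun x =>
      (complex.Re (fold_lie (form_app theta (bracket L2 L1)) l' x))%:C) x
  end.

Section ContactForm.
Variables (S U : set V) (rho : V -> R) (eqS : local_equation S U rho).
Variables (theta : field) (ctheta : contact_form S U theta).
Let Uo : open U. Proof. by case: eqS. Qed.
Let stheta : smooth_field_on U theta. Proof. by case: ctheta. Qed.

Lemma form_CH x v : U x -> S x -> CH S x v -> pairing (theta x) v = 0.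
Proof. by case: ctheta => _ + _; apply. Qed.

Lemma either_section_CH X x : either_section S U (H10 S) X -> U x -> S x -> CH S x (X x).
Proof.
move=> [] [_ XH] Ux Sx; first exact/H10_CH/XH.
by rewrite -[X]conjfK; apply: conjH10_CH; exact: XH.
Qed.

Lemma form_either_section X x : either_section S U (H10 S) X -> U x -> S x ->
  form_app theta X x = 0.
Proof. by move=> sX Ux Sx; rewrite /form_app form_CH //; exact: either_section_CH. Qed.

Lemma smooth_form_bracket X Y : smooth_field_on U X -> smooth_field_on U Y ->
  csmooth_on U (form_app theta (bracket X Y)).
Proof. by move=> sX sY; apply: csmooth_pairing => //; exact: smooth_field_bracket. Qed.

Lemma form_bracket_either X Y x : U x -> S x ->
  either_section S U (H10 S) X -> either_section S U (H10 S) Y ->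
  form_app theta (bracket X Y) x = pairing (contraction theta Y x) (X x).
Proof.
move=> Ux Sx sX sY; apply: (@form_bracket _ _ S U) => //.
- exact: either_section_smooth sX.
- exact: either_section_smooth sY.
- by move=> y Uy Sy; exact: form_either_section.
- by move=> y Uy Sy; exact: form_either_section.
- exact/CH_CT/either_section_CH.
- exact/CH_CT/either_section_CH.
Qed.

Lemma all_sections_smooth E l : all_sections S U E l ->
  forall i, (i < size l)%N -> smooth_field_on U (nth (fun=> 0) l i).
Proof. by move=> H i il; apply: either_section_smooth; [|exact: H]. Qed.

Lemma smooth_dual_covector E l : all_sections S U E l ->
  smooth_field_on U (dual_covector theta l).
Proof.
case: l => [_|L1 [|L2 l]]; first exact: smooth_field_cst.
  by move=> /all_sections_cons[/(either_section_smooth Uo) s1 _]; exact: smooth_contraction.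
move=> /all_sections_cons[/(either_section_smooth Uo) s1].
move=> /all_sections_cons[/(either_section_smooth Uo) s2 /all_sections_smooth sl] j.
under eq_fun do rewrite mxE.
apply: csmooth_cpart; apply: csmooth_Re; apply: csmooth_fold_lie => //.
exact: smooth_form_bracket.
Qed.

End ContactForm.
End DualForms.

(** * Subbundles: sections through a vector, kernels of covector fields *)

Section Subbundles.
Context {R : realType} {n : nat}.
Local Notation V := (pt R n).
Local Notation CV := (cvec R n).
Local Notation C := (R[i]).
Local Notation field := (V -> CV).
Implicit Types (S U : set V) (u v w : CV) (x : V) (X Y L : field) (E : V -> set CV).
Implicit Types (l : seq field) (theta : field).

Lemma open_neq0 U (g : V -> C) x : open U -> csmooth_on U g -> U x -> g x != 0 ->
  exists U', [/\ open U', U' x, U' `<=` U & forall y, U' y -> g y != 0].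
Proof.
move=> Uo [gr gi] Ux gx.
have real_case (h : V -> R) : smooth_on U h -> h x != 0 ->
    exists U', [/\ open U', U' x, U' `<=` U & forall y, U' y -> h y != 0].
  move=> sh hx; have ch := smooth_continuous sh Ux.
  have nh : \forall y \near x, h y != 0.
    exact: (cvgr_neq0 (h x) ch hx).
  have : nbhs x ([set y | h y != 0] `&` U) by apply: filterI => //; exact: open_nbhs_nbhs.
  rewrite nbhsE => -[U' [U'o U'x] sU'].
  by exists U'; split=> // y /sU' [].
have [gx0|gx0] := eqVneq (complex.Re (g x)) 0; last first.
  have [U' [? ? ? U'0]] := real_case _ gr gx0; exists U'; split=> // y /U'0.
  by apply: contra_neq => ->.
have gi0 : complex.Im (g x) != 0.
  by apply: contra_neq gx => gi0; exact: complex_eqP.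
have [U' [? ? ? U'0]] := real_case _ gi gi0; exists U'; split=> // y /U'0.
by apply: contra_neq => ->.
Qed.

Lemma sub_subbundle S U U' r E : open U' -> U' `<=` U ->
  subbundle S U r E -> subbundle S U' r E.
Proof.
move=> U'o sU [EH EX]; split=> [x /sU|x U'x Sx]; first exact: EH.
have [W [X [Wo Wx sW sX WE]]] := EX x (sU _ U'x) Sx.
exists (W `&` U'), X; split=> //; first exact: openI.
- by move=> i; apply: sub_smooth_field (sX i) => y [].
- by move=> y [Wy _]; exact: WE.
Qed.

Lemma eq_subbundle S U r E E' : (forall x, U x -> S x -> E x = E' x) ->
  subbundle S U r E -> subbundle S U r E'.
Proof.
move=> EE' [EH EX]; split=> [x Ux Sx|x Ux Sx]; first by rewrite -EE' //; exact: EH.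
have [W [X [Wo Wx sW sX WE]]] := EX x Ux Sx.
exists W, X; split=> // y Wy Sy; have [fX EyX] := WE y Wy Sy.
by rewrite -EE' //; exact: sW.
Qed.

Lemma subbundle_dim S U r E x : subbundle S U r E -> U x -> S x -> has_dim (E x) r.
Proof.
move=> [_ EX] Ux Sx; have [W [X [_ Wx _ _ WE]]] := EX x Ux Sx.
by have [fX ->] := WE x Wx Sx; exact: has_dim_span.
Qed.

Lemma subbundle_subspace S U r E x : subbundle S U r E -> U x -> S x -> is_subspace (E x).
Proof. by move=> bE Ux Sx; exact: has_dim_subspace (subbundle_dim bE Ux Sx). Qed.

(** The coordinates of [v] in a local frame at [x] serve as constant coefficients. *)
Lemma subbundle_section S U r E x v : subbundle S U r E -> U x -> S x -> E x v ->
  exists U' X, [/\ open U', U' x, U' `<=` U, section S U' E X & X x = v].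
Proof.
move=> bE Ux Sx Exv; have [_ EX] := bE; have [W [X [Wo Wx sW sX WE]]] := EX x Ux Sx.
have [fX EE] := WE x Wx Sx.
have vS : v \in <<[tuple X i x | i < r]>>%VS by move: Exv; rewrite EE.
pose a i := coord [tuple X i x | i < r] i v.
have va : v = \sum_i a i *: X i x.
  rewrite [LHS](coord_span vS); apply: eq_bigr => i _.
  by rewrite -tnth_nth tnth_mktuple.
exists W, (fun y => \sum_i a i *: X i y); split=> //.
split.
  apply: smooth_field_sum => // i.
  by apply: smooth_field_scale => //; exact: csmooth_cst.
move=> y Wy Sy; have [_ ->] := WE y Wy Sy.
apply: rpred_sum => i _; apply: rpredZ; apply: memv_span.
by apply/mapP; exists i; rewrite ?mem_enum.
Qed.

Lemma kernel_subbundle S U r E (W : field) : open U -> subbundle S U r E ->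
  smooth_field_on U W ->
  (forall x, U x -> S x -> exists2 v, E x v & pairing (W x) v != 0) ->
  exists r', subbundle S U r' (fun x => E x `&` [set v | pairing (W x) v = 0]).
Proof.
move=> Uo bE sW Wv; have [EH EX] := bE.
exists r.-1; split=> [x Ux Sx v [Ev _]|x Ux Sx]; first exact: EH Ev.
(* Rank 0 is impossible at a point of [S], where the fiber contains a vector with nonzero
   pairing. *)
case: r bE EX => [|r] bE EX.
  have [v Ev Wv0] := Wv x Ux Sx.
  by have [] := has_dim_ker (subbundle_dim bE Ux Sx) Ev Wv0.
have [U' [X [U'o U'x sU' sX XE]]] := EX x Ux Sx.
have [i0 Xi0] : exists i0, pairing (W x) (X i0 x) != 0.
  apply: contrapT => nX; have [v] := Wv x Ux Sx.
  have [fX ->] := XE x U'x Sx.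
  move=> vS; have {vS} vS : v \in <<[tuple X i x | i < r.+1]>>%VS by [].
  move/eqP; apply; rewrite (coord_span vS).
  apply: (big_ind (fun u => pairing (W x) u = 0)); first exact: pairing0.
    by move=> a b a0 b0; rewrite pairingD a0 b0 addr0.
  move=> i _; rewrite pairingZ -tnth_nth tnth_mktuple.
  have -> : pairing (W x) (X i x) = 0; last by rewrite mulr0.
  by apply/eqP; apply: contrapT => /negP Xi; apply: nX; exists i.
have sp i : csmooth_on U' (fun y => pairing (W y) (X i y)).
  by apply: csmooth_pairing => //; exact: sub_smooth_field sW.
have [U'' [U''o U''x sU'' nz]] := open_neq0 U'o (sp i0) U'x Xi0.
exists U'', (fun (k : 'I_r) y => pairing (W y) (X i0 y) *: X (lift i0 k) y -
              pairing (W y) (X (lift i0 k) y) *: X i0 y); split=> //.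
- exact: subset_trans sU'' sU'.
- move=> k; apply: sub_smooth_field sU'' _.
  apply: smooth_field_add => //; first exact: (smooth_field_scale U'o (sp i0) (sX _)).
  under eq_fun do rewrite -scaleNr.
  by apply: smooth_field_scale => //; apply: csmooth_opp.
move=> y U''y Sy; have [fX ->] := XE y (sU'' _ U''y) Sy.
exact: (span_ker_frame fX (nz y U''y)).
Qed.

End Subbundles.

(** * Dual forms as smooth covectors, and lowering of the order *)

Section DualFormValue.
Context {R : realType} {n : nat}.
Local Notation V := (pt R n).
Local Notation CV := (cvec R n).
Local Notation C := (R[i]).
Local Notation field := (V -> CV).
Implicit Types (U : set V) (u v w : CV) (x : V) (X Y L : field) (E : V -> set CV).
Implicit Types (l : seq field).
Variables (S U : set V) (rho : V -> R) (eqS : local_equation S U rho).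
Variables (theta : field) (ctheta : contact_form S U theta).
Let Uo : open U. Proof. by case: eqS. Qed.

(** The value depends on [L] only at [x]. For one field this is [form_bracket], applied where both
    neighborhoods overlap; for longer lists the form is a differential. *)
Lemma dual_form_onE l U' L x : all_sections S U (H10 S) l -> U x -> S x ->
  open U' -> U' x -> section S U' (H10 S) L ->
  dual_form_on theta l L x = pairing (dual_covector theta l x) (L x).
Proof.
move=> sl Ux Sx U'o U'x sL; case: l sl => [|L1 [|L2 l]] sl /=.
- by rewrite /pairing big1 // => j _; rewrite mxE mul0r.
- have sU : U `&` U' `<=` U by move=> y [].
  have sU' : U `&` U' `<=` U' by move=> y [].
  have eqS' := local_equationS (openI Uo U'o) sU eqS.
  have ct' : contact_form S (U `&` U') theta.
    case: ctheta => st tCH tnz; split; first exact: sub_smooth_field st.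
      by move=> y v [Uy _]; exact: tCH.
    by move=> y [Uy _]; exact: tnz.
  apply: (form_bracket_either eqS' ct') => //; first by left; exact: sub_section sL.
  by move/all_sections_cons: sl => [sL1 _]; exact: sub_either_section sL1.
rewrite /lie_derive cderiveE; apply: eq_bigr => j _.
by rewrite mxE mulrC.
Qed.

(** A section through [v] exists and every such section gives the same value, so the choice made by
    [xget] is determined. *)
Lemma dual_formE r l x v : subbundle S U r (H10 S) -> all_sections S U (H10 S) l ->
  U x -> S x -> H10 S x v ->
  dual_form S theta l x v = pairing (dual_covector theta l x) v.
Proof.
move=> bH sl Ux Sx vH; rewrite /dual_form.
have [U' [X [U'o U'x sU' sX Xv]]] := subbundle_section bH Ux Sx vH.
case: xgetP => [c _ [U1 [L [U1o U1x sL Lv ->]]]|noc].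
  by rewrite (dual_form_onE sl Ux Sx U1o U1x sL) Lv.
case: (noc (pairing (dual_covector theta l x) v)); exists U', X; split=> //.
by rewrite (dual_form_onE sl Ux Sx U'o U'x sX) Xv.
Qed.

Lemma dual_covector_real L1 L2 l x v :
  pairing (dual_covector theta [:: L1, L2 & l] x) v =
  cderive (fun x => (complex.Re
    (fold_lie (form_app theta (bracket L2 L1)) l x))%:C) x v.
Proof. by rewrite cderiveE; apply: eq_bigr => j _; rewrite mxE mulrC. Qed.

(** Write g for the iterated derivative without [Y]. Replacing [L1] by [i1] multiplies g by i, whose
    real part is then - Im g; the two hypotheses say that [Y x] kills both Re g and Im g. *)
Lemma real_fold_eq0 L1 L2 l (Y : field) x :
  either_section S U (H10 S) L1 -> either_section S U (H10 S) L2 ->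
  all_sections S U (H10 S) l -> U x ->
  let i1 := fun y => 'i *: L1 y in
  pairing (dual_covector theta [:: L1, L2 & l] x) (Y x) = 0 ->
  pairing (dual_covector theta [:: i1, L2 & l] x) (Y x) = 0 ->
  fold_lie (form_app theta (bracket L2 L1)) (rcons l Y) x = 0.
Proof.
move=> s1 s2 sl Ux i1; rewrite !dual_covector_real => z1 z2.
have sm1 := either_section_smooth Uo s1; have sm2 := either_section_smooth Uo s2.
have st : smooth_field_on U theta by case: ctheta.
have sf := smooth_form_bracket eqS ctheta sm2 sm1.
have sml := all_sections_smooth eqS sl.
rewrite /fold_lie foldl_rcons -/(fold_lie _ _) /lie_derive cderive_split z1 add0r.
have iE y : U y -> fold_lie (form_app theta (bracket L2 i1)) l y =
    'i * fold_lie (form_app theta (bracket L2 L1)) l y.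
  move=> Uy; apply: (fold_lie_scale Uo sf sml) Uy => z Uz.
  by rewrite /form_app (bracket_scale _ _ sm1 Uz) pairingZ.
suff : cderive (fun y => (complex.Im
    (fold_lie (form_app theta (bracket L2 L1)) l y))%:C) x (Y x) = 0.
  by move=> ->; rewrite mulr0.
have sI : csmooth_on U (fun y => (complex.Im
    (fold_lie (form_app theta (bracket L2 L1)) l y))%:C).
  by apply: csmooth_real; have [] := csmooth_fold_lie Uo sf sml.
apply/eqP; rewrite -oppr_eq0 -mulN1r -(@cderive_scale _ _ U) //; apply/eqP.
rewrite -[RHS]z2; apply: (eq_cderive Uo _ Ux) => y Uy.
rewrite (iE y Uy) ReM /= mul0r sub0r mul1r mulN1r.
by apply: complex_eqP; rewrite /= ?oppr0.
Qed.

(* If the real part of [L^t .. theta [L^2, L^1]] is nonzero at [x], then deleting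
   [L^t] yields, after rotating [L^1] by [i] if necessary, a dual form of lower
   order that is nonzero on the value of [L^t] or of its conjugate. *)
Lemma lower_dual E L1 L2 l x :
  (forall y, U y -> S y -> E y `<=` H10 S y) ->
  (forall y, U y -> S y -> is_subspace (E y)) ->
  all_sections S U E [:: L1, L2 & l] -> U x -> S x ->
  complex.Re (fold_lie (form_app theta (bracket L2 L1)) l x) != 0 ->
  exists l0 v, [/\ size l0 = (size l).+1, all_sections S U E l0, E x v &
    pairing (dual_covector theta l0 x) v != 0].
Proof.
move=> EH Esub /all_sections_cons[s1 /all_sections_cons[s2 sl]] Ux Sx.
have sH X : either_section S U E X -> either_section S U (H10 S) X.
  exact: either_section_weaken.
have single X : either_section S U E X -> all_sections S U E [:: X].
  by move=> sX; apply/all_sections_cons; split=> // i.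
case/lastP: l sl => [_|l Y /all_sections_rcons[sY sl]] f0.
  have {f0} : form_app theta (bracket L2 L1) x != 0.
    by apply: contra_neq f0 => /= ->.
  (* With only two fields, the bracket itself is a value of an order-two form: that of [[:: L1]] at
     [L2 x], or up to sign that of [[:: L2]] at [L1 x], according to which field has type (1,0). *)
  case: (s2) => [[_ E2]|c2].
    rewrite (form_bracket_either eqS ctheta) //; try exact: sH.
    by move=> nz; exists [:: L1], (L2 x); split=> //; [exact: single|exact: E2].
  case: (s1) => [[_ E1]|c1].
    rewrite /form_app bracket_anti -scaleN1r pairingZ mulN1r oppr_eq0.
    rewrite -/(form_app theta (bracket L1 L2) x) (form_bracket_either eqS ctheta) //; try exact: sH.
    by move=> nz; exists [:: L2], (L1 x); split=> //; [exact: single|exact: E1].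
  (* If both fields have type (0,1), integrability puts the conjugate of their bracket in [H10], so
     [theta] kills the bracket, against the assumption. *)
  have {}c1 := section_weaken EH c1; have {}c2 := section_weaken EH c2.
  rewrite /form_app -[L1]conjfK -[L2]conjfK.
  rewrite (bracket_conj (section_smooth c2) (section_smooth c1) Ux).
  rewrite (form_CH ctheta Ux Sx) ?eqxx //.
  exact/conjH10_CH/(bracket_H10 eqS c2 c1).
have {f0} fnz : fold_lie (form_app theta (bracket L2 L1)) (rcons l Y) x != 0.
  by apply: contra_neq f0 => ->.
pose i1 := fun y => 'i *: L1 y.
have si1 : either_section S U E i1 by exact: either_section_scale.
have [X1 [sX1 X1nz]] : exists X1, either_section S U E X1 /\
    pairing (dual_covector theta [:: X1, L2 & l] x) (Y x) != 0.
  apply: contrapT => nX; move/eqP: fnz; apply.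
  apply: real_fold_eq0 => //; try exact: sH.
  - exact: all_sections_weaken sl.
  - by apply/eqP; apply: contrapT => /negP z; apply: nX; exists L1.
  - by apply/eqP; apply: contrapT => /negP z; apply: nX; exists i1.
have sX : all_sections S U E [:: X1, L2 & l].
  by apply/all_sections_cons; split=> //; apply/all_sections_cons.
case: sY => [[_ EY]|[_ EY]].
  by exists [:: X1, L2 & l], (Y x); split; rewrite ?size_rcons //; exact: EY.
exists [:: X1, L2 & l], (conjv (Y x)); split; rewrite ?size_rcons //; first exact: EY.
rewrite dual_covector_real cderive_real_conj conjc_eq0 -dual_covector_real.
exact: X1nz.
Qed.

End DualFormValue.

(** * Towers *)

Section Towers.
Context {R : realType} {n : nat}.
Local Notation V := (pt R n).
Local Notation CV := (cvec R n).
Local Notation C := (R[i]).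
Local Notation field := (V -> CV).
Implicit Types (S U : set V) (u v w : CV) (x : V) (X Y L theta : field).
Implicit Types (l : seq field) (E : nat -> V -> set CV) (tau : multi_order n).

Lemma sub_contact_form S U U' theta : U' `<=` U ->
  contact_form S U theta -> contact_form S U' theta.
Proof.
move=> sU [st tCH tnz]; split; first exact: sub_smooth_field st.
  by move=> y v /sU; exact: tCH.
by move=> y /sU; exact: tnz.
Qed.

Lemma sub_E_dual S U U' theta (F : V -> set CV) t omega : U' `<=` U ->
  E_dual S U theta F t omega -> E_dual S U' theta F t omega.
Proof. by move=> sU [t2 [l [sl Fl ol]]]; split=> //; exists l; split=> //; exact: sub_all_sections Fl. Qed.

Lemma sub_tower S U U' theta m E tau : open U' -> U' `<=` U ->
  tower S U theta m E tau -> tower S U' theta m E tau.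
Proof.
move=> U'o sU [mn E0 Ek tauN tauS]; split=> //.
- by move=> x /sU; exact: E0.
- by move=> k /Ek[r bE]; exists r; exact: sub_subbundle bE.
move=> k /tauS[t [omega [tk dE nz EE]]]; exists t, omega; split=> //.
- exact: sub_E_dual dE.
- by move=> x /sU; exact: nz.
- by move=> x /sU; exact: EE.
Qed.

Lemma lex_lt_irrefl tau : ~ lex_lt tau tau.
Proof. by move=> [k [+ _]]; case: (tnth tau k) => //= s; rewrite ltnn. Qed.

Lemma order_lt_trans a b c : order_lt a b -> order_lt b c -> order_lt a c.
Proof. by case: a b c => [a|] [b|] [c|] //=; exact: ltn_trans. Qed.

Lemma lex_lt_trans sigma tau ups : lex_lt sigma tau -> lex_lt tau ups -> lex_lt sigma ups.
Proof.
move=> [i [iL iE]] [j [jL jE]]; case: (ltngtP i j) => ij.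
- exists i; split; first by rewrite -jE.
  by move=> k ki; rewrite iE // jE // (ltn_trans ki).
- exists j; split; first by rewrite iE.
  by move=> k kj; rewrite iE ?jE // (ltn_trans kj).
- have {}ij : i = j by exact: val_inj.
  subst j; exists i; split; first exact: order_lt_trans iL jL.
  by move=> k ki; rewrite iE // jE.
Qed.

Lemma lex_le_lt_trans sigma tau ups : lex_le sigma tau -> lex_lt tau ups -> lex_lt sigma ups.
Proof. by move=> [->|] //; exact: lex_lt_trans. Qed.

Lemma lex_le_trans sigma tau ups : lex_le sigma tau -> lex_le tau ups -> lex_le sigma ups.
Proof. by move=> H [<-//|tu]; right; exact: lex_le_lt_trans tu. Qed.

(** A section through [v] keeps the form of [l] nonzero on every fiber near [x]. There the tower can
    be cut off after [E k] and continued by the kernel of this form, whose order is less than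
    [t]. *)
Lemma smaller_tower S U rho theta m E tau (k : 'I_n.-1) t l x v :
  local_equation S U rho -> contact_form S U theta -> tower S U theta m E tau ->
  (k < m)%N -> tnth tau k = Some t -> (0 < size l)%N -> ((size l).+1 < t)%N ->
  all_sections S U (E k) l -> U x -> S x -> E k x v ->
  pairing (dual_covector theta l x) v != 0 ->
  exists2 sigma, tower_order_at S x sigma & lex_lt sigma tau.
Proof.
move=> eqS ctheta tow km tk l0 lt sl Ux Sx Ev nz.
have Uo : open U by case: eqS.
have [mn E0 Ek tauN tauS] := tow.
have [r bE] := Ek k (ltnW km).
have [r0 bE0] := Ek 0%N (leq0n m); have bH := eq_subbundle E0 bE0.
have EH : forall y, U y -> S y -> E k y `<=` H10 S y by case: bE.
have slH := all_sections_weaken EH sl.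
have sW := smooth_dual_covector eqS ctheta sl.
have [U1 [X [U1o U1x sU1 sX Xv]]] := subbundle_section bE Ux Sx Ev.
have sp : csmooth_on U1 (fun y => pairing (dual_covector theta l y) (X y)).
  apply: csmooth_pairing => //; last exact: section_smooth sX.
  exact: sub_smooth_field sW.
have nzx : pairing (dual_covector theta l x) (X x) != 0 by rewrite Xv.
have [U2 [U2o U2x sU2 nz2]] := open_neq0 U1o sp U1x nzx.
have sU : U2 `<=` U by exact: subset_trans sU1.
pose F y := E k y `&` [set u | pairing (dual_covector theta l y) u = 0].
have FE y : U2 y -> S y -> E k y `&` [set u | dual_form S theta l y u = 0] = F y.
  move=> U2y Sy; apply/seteqP; split=> u [Eu u0]; split=> //=.
    by rewrite -(dual_formE eqS ctheta bH slH (sU _ U2y) Sy) //; exact: (EH _ (sU _ U2y)).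
  by rewrite (dual_formE eqS ctheta bH slH (sU _ U2y) Sy) //; exact: (EH _ (sU _ U2y)).
have nzE y : U2 y -> S y -> exists2 u, E k y u & pairing (dual_covector theta l y) u != 0.
  move=> U2y Sy; exists (X y); last exact: nz2.
  by have [_] := sX; apply => //; exact: sU2.
(* The comparison is decided at [k], so the later entries may become infinite and the new tower ends
   with index k + 1. *)
pose sigma : multi_order n := [tuple if (i < k)%N then tnth tau i else
  if i == k then Some (size l).+1 else None | i < n.-1].
pose E' j y := if (j <= k)%N then E j y else E k y `&` [set u | dual_form S theta l y u = 0].
have E'k j : (j <= k)%N -> E' j = E j by move=> jk; apply/funext => y; rewrite /E' jk.
exists sigma; last first.
  exists k; split; first by rewrite tnth_mktuple ltnn eqxx tk.
  by move=> j jk; rewrite tnth_mktuple jk.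
exists U2, theta, k.+1, E'; split=> //; first exact: sub_contact_form ctheta.
split.
- exact: leq_trans km mn.
- by move=> y /sU Uy Sy; rewrite E'k //; exact: E0.
- move=> j; rewrite leq_eqVlt => /orP[/eqP ->|jk]; last first.
    have [r' bEj] := Ek j (leq_trans (ltnW jk) km).
    by rewrite E'k //; exists r'; exact: sub_subbundle bEj.
  have [r' bF] := kernel_subbundle U2o (sub_subbundle U2o sU bE) (sub_smooth_field sU sW) nzE.
  by exists r'; apply: eq_subbundle bF => y U2y Sy; rewrite /E' ltnn FE.
- by move=> j kj; rewrite tnth_mktuple ltnNge (ltnW kj) /= -val_eqE gtn_eqF.
move=> j; rewrite ltnS leq_eqVlt => /orP[/eqP jk|jk].
  have {}jk : j = k by exact: val_inj.
  subst j; exists (size l).+1, (dual_form S theta l); split.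
  - by rewrite tnth_mktuple ltnn eqxx.
  - rewrite E'k //; split; first by rewrite ltnS.
    by exists l; split=> //; exact: (sub_all_sections sU sl).
  - move=> y U2y Sy; have [u Eu u0] := nzE y U2y Sy; rewrite E'k //; exists u; split=> //.
    by rewrite (dual_formE eqS ctheta bH slH (sU _ U2y) Sy) //; exact: (EH _ (sU _ U2y)).
  - by move=> y U2y Sy; rewrite /E' ltnn leqnn.
have [t' [omega [tj dE nzj EE]]] := tauS j (ltn_trans jk km).
exists t', omega; split.
- by rewrite tnth_mktuple jk.
- by rewrite E'k ?(ltnW jk) //; exact: sub_E_dual dE.
- by move=> y /sU Uy Sy; rewrite E'k ?(ltnW jk) //; exact: nzj.
- by move=> y /sU Uy Sy; rewrite !E'k ?(ltnW jk) //; exact: EE.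
Qed.

(** [dual_formE] trades the dual forms of a tower for smooth covector fields, to which linear
    algebra and differentiation apply. The lists are indexed by natural numbers, as the subbundles
    are. *)
Lemma tower_covectors S U rho theta m E tau :
  local_equation S U rho -> contact_form S U theta -> tower S U theta m E tau ->
  exists ls : nat -> seq field, forall k : 'I_n.-1, (k < m)%N ->
    [/\ tnth tau k = Some (size (ls k)).+1, (0 < size (ls k))%N,
        all_sections S U (E k) (ls k),
        forall x, U x -> S x -> exists2 v, E k x v &
          pairing (dual_covector theta (ls k) x) v != 0 &
        forall x, U x -> S x -> E k.+1 x =
          E k x `&` [set v | pairing (dual_covector theta (ls k) x) v = 0]].
Proof.
move=> eqS ctheta [mn E0 Ek tauN tauS].
have [r0 bE0] := Ek 0%N (leq0n m); have bH := eq_subbundle E0 bE0.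
suff /choice[ls lsP] : forall k, exists l, forall k' : 'I_n.-1, k' = k :> nat -> (k < m)%N ->
    [/\ tnth tau k' = Some (size l).+1, (0 < size l)%N,
        all_sections S U (E k) l,
        forall x, U x -> S x -> exists2 v, E k x v & pairing (dual_covector theta l x) v != 0 &
        forall x, U x -> S x -> E k.+1 x =
          E k x `&` [set v | pairing (dual_covector theta l x) v = 0]].
  by exists ls => k km; exact: lsP.
move=> k; have [km|mk] := boolP (k < m)%N; last by exists [::].
have [t [omega [tk [t2 [l [sl El ol]]] nz EE]]] := tauS (Ordinal (leq_trans km mn)) km.
have [r bE] := Ek k (ltnW km).
have EH : forall y, U y -> S y -> E k y `<=` H10 S y by case: bE.
have slH := all_sections_weaken EH El.
have tl : t = (size l).+1 by rewrite sl prednK // (leq_trans _ t2).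
exists l => k' k'k _; split=> //.
- by rewrite -tl -tk; congr (tnth _ _); exact: val_inj.
- by rewrite sl -ltnS prednK // (leq_trans _ t2).
- move=> x Ux Sx; have [v [Ev v0]] := nz x Ux Sx; exists v => //.
  by rewrite -(dual_formE eqS ctheta bH slH Ux Sx) -?ol //; exact: EH Ev.
move=> x Ux Sx; rewrite EE //=; apply/seteqP; split=> v [Ev v0]; split=> //=.
  by rewrite -(dual_formE eqS ctheta bH slH Ux Sx) -?ol //; exact: EH Ev.
by rewrite ol (dual_formE eqS ctheta bH slH Ux Sx) //; exact: EH Ev.
Qed.

End Towers.

(** * Triangular systems of covectors *)

Section Triangular.
Context {R : realType} {n : nat}.
Local Notation V := (pt R n).
Local Notation CV := (cvec R n).
Local Notation C := (R[i]).
Local Notation field := (V -> CV).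
Implicit Types (A : set CV) (u v w : CV) (s : seq (CV * CV)).

(* Pairs [(w_i, e_i)] of a covector and a vector such that the matrix
   [w_i(e_j)] is lower triangular with nonzero diagonal. *)
Definition triangular s :=
  pairwise (fun p q => pairing p.1 q.2 == 0) s && all (fun p => pairing p.1 p.2 != 0) s.

(** The first covector lowers the dimension by one and kills all later vectors, so the rest of the
    system is triangular on its kernel in [A]. *)
Lemma triangular_dim A d s : has_dim A d -> triangular s ->
  (forall p, p \in s -> A p.2) ->
  has_dim (A `&` [set v | forall p, p \in s -> pairing p.1 v = 0]) (d - size s).
Proof.
elim: s A d => [|[w e] s IH] A d dA.
  by rewrite subn0 (_ : _ `&` _ = A) //; apply/seteqP; split=> [v []|v Av].
rewrite /triangular /= => /andP[/andP[/allP we tri] /andP[w0 s0]] sA.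
have Ae : A e by apply: (sA (w, e)); rewrite mem_head.
have [d0 dA'] := has_dim_ker dA Ae w0.
have := IH _ _ dA' _ _; rewrite (_ : (d.-1 - size s)%N = (d - (size s).+1)%N); last first.
  by case: d d0 {dA dA'} => // d _; rewrite subSS.
rewrite /triangular tri s0 => /(_ isT) H.
rewrite (_ : _ `&` _ = A `&` [set v | pairing w v = 0] `&`
    [set v | forall p, p \in s -> pairing p.1 v = 0]); last first.
  apply/seteqP; split=> v.
    move=> [Av H1]; split; first by split=> //; apply: (H1 (w, e)); rewrite mem_head.
    by move=> p ps; apply: H1; rewrite in_cons ps orbT.
  move=> [[Av wv] H1]; split=> // p; rewrite in_cons => /orP[/eqP -> //|].
  exact: H1.
apply: H => p ps; split; first by apply: sA; rewrite in_cons ps orbT.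
exact/eqP/(we _ ps).
Qed.

(** Substitution: a multiple of the first vector adjusts the first value. The remaining values, with
    the contribution of that multiple subtracted, are prescribed inside the kernel of the first
    covector. *)
Lemma triangular_solve A s (z : nat -> C) : is_subspace A -> triangular s ->
  (forall p, p \in s -> A p.2) ->
  exists2 v, A v & forall i, (i < size s)%N -> pairing (nth (0, 0) s i).1 v = z i.
Proof.
elim: s A z => [|[w e] s IH] A z subA; first by exists 0 => //; case: subA.
rewrite /triangular /= => /andP[/andP[/allP we tri] /andP[w0 s0]] sA.
have Ae : A e by apply: (sA (w, e)); rewrite mem_head.
pose a := z 0%N / pairing w e.
have [|||v [Av wv] vz] := IH (A `&` [set v | pairing w v = 0])
    (fun i => z i.+1 - a * pairing (nth (0, 0) s i).1 e).
- by apply: subspaceI => //; exact: subspace_ker.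
- by rewrite /triangular tri.
- move=> p ps; split; first by apply: sA; rewrite in_cons ps orbT.
  exact/eqP/(we _ ps).
exists (a *: e + v); first by case: subA => _; apply.
move=> [_|i] /=; first by rewrite pairingD pairingZ wv addr0 /a divfK.
by rewrite ltnS => /vz vi; rewrite pairingD pairingZ vi addrC subrK.
Qed.

End Triangular.

(** * The Levi kernel *)

Section LeviKernel.
Context {R : realType} {n : nat}.
Local Notation V := (pt R n).
Local Notation CV := (cvec R n).
Local Notation C := (R[i]).
Local Notation field := (V -> CV).
Implicit Types (u v w : CV) (x : V) (X Y L : field).
Variables (S U : set V) (rho : V -> R) (eqS : local_equation S U rho).
Let Uo : open U. Proof. by case: eqS. Qed.

(** The Levi kernel quantifies over every section [L] through the given vector. For a u + v, choose
    a section [X] through u and split L = a X + (L - a X), where the second term passes through v.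
    The zero vector is the case of [bracket_zero_H10]. *)
Lemma levi_kernel_subspace r x : subbundle S U r (H10 S) -> U x -> S x ->
  is_subspace (levi_kernel S x).
Proof.
move=> bH Ux Sx; have [H0 HD] := H10_subspace S x.
split=> [|a u v [uH uL] [vH vL]]; split=> //; last first.
- move=> W L L' Wo Wx sL sL' Lx.
  have [U1 [X [U1o U1x sU1 sX Xu]]] := subbundle_section bH Ux Sx uH.
  pose Q := W `&` U1.
  have Qo : open Q by exact: openI.
  have QW : Q `<=` W by move=> y [].
  have QU1 : Q `<=` U1 by move=> y [].
  have sXQ := sub_section QU1 sX; have sLQ := sub_section QW sL.
  have sL'Q := sub_section QW sL'.
  have [smX XH] := sXQ; have [smL LH] := sLQ; have [smL' L'H] := sL'Q.
  have aX : smooth_field_on Q (fun y => (- a) *: X y).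
    by apply: smooth_field_scale => //; exact: csmooth_cst.
  have sY : section S Q (H10 S) (fun y => (- a) *: X y + L y).
    split=> [|y Qy Sy]; first exact: smooth_field_add.
    by have [_] := H10_subspace S y; apply; [exact: XH|exact: LH].
  have Yx : (- a) *: X x + L x = v by rewrite Xu Lx addrA -scalerDl addNr scale0r add0r.
  have sub Z Z' : smooth_field_on Q Z -> smooth_field_on Q Z' ->
      bracket (fun y => Z y + Z' y) (conjf L') x = bracket Z (conjf L') x + bracket Z' (conjf L') x.
    move=> sZ sZ'; rewrite !bracketE addrACA; congr (_ + _).
      by apply/rowP => j; rewrite [LHS]mxE [RHS]mxE [X in _ = X + _]mxE [X in _ = _ + X]mxE cderiveD.
    rewrite -opprD; congr (- _); apply/rowP => j.
    rewrite [LHS]mxE [RHS]mxE [X in _ = X + _]mxE [X in _ = _ + X]mxE.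
    have -> : (fun y => (Z y + Z' y) ord0 j) = (fun y => Z y ord0 j + Z' y ord0 j).
      by apply/funext => y; rewrite mxE.
    exact: (cderive_add _ (sZ j) (sZ' j) (conj Wx U1x)).
  have scale Z : smooth_field_on Q Z ->
      bracket (fun y => a *: Z y) (conjf L') x = a *: bracket Z (conjf L') x.
    move=> sZ; rewrite bracket_anti (@bracket_scale _ _ Q) //.
    by rewrite -scalerN -bracket_anti.
  have eL : L = (fun y => a *: X y + ((- a) *: X y + L y)).
    by apply/funext => y; rewrite addrA -scalerDl subrr scale0r add0r.
  rewrite eL sub; [|by apply: smooth_field_scale => //; exact: csmooth_cst|by case: sY].
  rewrite scale //; have [_] := CH_subspace S x; apply.
    exact: (uL Q).
  exact: (vL Q).
- exact: HD.
move=> W L L' Wo Wx sL sL' Lx.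
have QW : W `&` U `<=` W by move=> y [].
have QU : W `&` U `<=` U by move=> y [].
have eqS' := local_equationS (openI Wo Uo) QU eqS.
have sL'Q := sub_section QW sL'.
apply: H10_CH; apply: (bracket_zero_H10 eqS' (sub_section QW sL)) => //.
  by apply: smooth_field_conj => //; [exact: openI|exact: section_smooth sL'Q].
exact: section_conj_tangent.
Qed.

(** The pairing is theta([X, L1]) for a section [X] through [v]. It vanishes by integrability if
    [L1] has type (1,0), and by the definition of the Levi kernel if [L1] has type (0,1). *)
Lemma levi_kernel_contraction r theta (L1 : field) x v : subbundle S U r (H10 S) ->
  contact_form S U theta -> either_section S U (H10 S) L1 -> U x -> S x ->
  levi_kernel S x v -> pairing (contraction theta L1 x) v = 0.
Proof.
move=> bH ctheta sL1 Ux Sx [vH vL].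
have [U1 [X [U1o U1x sU1 sX Xv]]] := subbundle_section bH Ux Sx vH.
have eqS1 := local_equationS U1o sU1 eqS.
have ct1 := sub_contact_form sU1 ctheta.
have sL1' := sub_either_section sU1 sL1.
rewrite -Xv -(form_bracket_either eqS1 ct1) //; last by left.
apply: (form_CH ct1) => //.
case: sL1' => [sL|sL]; first exact/H10_CH/(bracket_H10 eqS1).
by rewrite -[L1]conjfK; exact: (vL U1).
Qed.

End LeviKernel.

(** * The CR submanifold of a tower *)

Section RowFunctions.
Context {R : realType} {V : normedModType R}.

Lemma smooth_row c U (F : 'I_c -> V -> R) : open U -> (forall j, smooth_on U (F j)) ->
  smooth_on U (fun y => \row_j F j y).
Proof.
move=> Uo sF.
have -> : (fun y => \row_j F j y) = (fun y => \sum_j F j y *: delta_mx ord0 j : 'rV_c).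
  by apply/funext => y; rewrite [LHS]row_sum_delta; apply: eq_bigr => j _; rewrite mxE.
by apply: smooth_sum => // j _; exact: smooth_scale.
Qed.

Lemma derive_row c (F : 'I_c -> V -> R) x v : (forall j, derivable (F j) x v) ->
  'D_v (fun y => \row_j F j y) x = \row_j 'D_v (F j) x.
Proof.
have FE (i : 'I_1) j : (fun y => (\row_j F j y) i j) = F j.
  by apply/funext => y; rewrite mxE.
move=> dF; rewrite derive_mx; last first.
  by apply/derivable_mxP => i j; rewrite FE.
by apply/rowP => j; rewrite [LHS]mxE [RHS]mxE FE.
Qed.

End RowFunctions.

Section TowerManifold.
Context {R : realType} {n : nat}.
Local Notation V := (pt R n).
Local Notation CV := (cvec R n).
Local Notation C := (R[i]).
Local Notation field := (V -> CV).
Implicit Types (u v w : CV) (x : V) (l : seq field).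

(** The function whose differential is the dual form of a list of at least two fields; an order-two
    form has no such potential, and shorter lists get the constant 0. *)
Definition real_form (theta : field) l : V -> R :=
  match l with
  | [:: L1, L2 & l'] => fun x =>
      complex.Re (fold_lie (form_app theta (bracket L2 L1)) l' x)
  | _ => fun=> 0
  end.

Lemma real_formE theta l x v : (1 < size l)%N ->
  pairing (dual_covector theta l x) v = cderive (fun y => (real_form theta l y)%:C) x v.
Proof. by case: l => [|L1 [|L2 l]] // _; exact: dual_covector_real. Qed.

Variables (S U : set V) (rho : V -> R) (eqS : local_equation S U rho).
Variables (theta : field) (ctheta : contact_form S U theta).
Variables (m : nat) (E : nat -> V -> set CV) (tau : multi_order n).
Hypothesis tow : tower S U theta m E tau.
Variable ls : nat -> seq field.
Hypothesis lsP : forall k : 'I_n.-1, (k < m)%N ->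
    [/\ tnth tau k = Some (size (ls k)).+1, (0 < size (ls k))%N,
        all_sections S U (E k) (ls k),
        forall x, U x -> S x -> exists2 v, E k x v &
          pairing (dual_covector theta (ls k) x) v != 0 &
        forall x, U x -> S x -> E k.+1 x =
          E k x `&` [set v | pairing (dual_covector theta (ls k) x) v = 0]].

Let Uo : open U. Proof. by case: eqS. Qed.

(** The order is the size of the list plus one, so [1 < size (ls k)] selects the forms of order at
    least three. *)
Definition real_indices : seq 'I_n.-1 :=
  [seq k : 'I_n.-1 <- enum 'I_n.-1 | (k < m)%N && (1 < size (ls k))%N].

Definition tower_manifold : set V := S `&` U `&`
  [set x | forall k, k \in real_indices -> real_form theta (ls k) x = 0].

Lemma mem_real_indices k : (k \in real_indices) = (k < m)%N && (1 < size (ls k))%N.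
Proof. by rewrite mem_filter mem_enum andbT. Qed.

Lemma tower_H10 : exists r, subbundle S U r (H10 S).
Proof.
have [mn E0 Ek _ _] := tow; have [r0 bE0] := Ek 0%N (leq0n m).
by exists r0; exact: eq_subbundle E0 bE0.
Qed.

Lemma tower_nested x j k : U x -> S x -> (j <= k <= m)%N -> E k x `<=` E j x.
Proof.
move=> Ux Sx /andP[+ km]; have [mn _ _ _ _] := tow.
elim: k km => [|k IH] km; first by rewrite leqn0 => /eqP ->.
rewrite leq_eqVlt => /orP[/eqP ->//|jk].
have [_ _ _ _ EE] := @lsP (Ordinal (leq_trans km mn)) km.
by rewrite (EE x Ux Sx) => v [Ev _]; exact: IH (ltnW km) jk v Ev.
Qed.

Lemma tower_sub_H10 x k : U x -> S x -> (k <= m)%N -> E k x `<=` H10 S x.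
Proof. by move=> Ux Sx km; have [_ _ Ek _ _] := tow; have [r [EH _]] := Ek k km; exact: EH. Qed.

Lemma tower_dim x k : U x -> S x -> (k <= m)%N -> has_dim (E k x) (n.-1 - k).
Proof.
move=> Ux Sx; have [mn E0 _ _ _] := tow.
elim: k => [_|k IH km]; first by rewrite subn0 E0 //; exact: H10_dim eqS _ _ _.
have [_ _ _ nz EE] := @lsP (Ordinal (leq_trans km mn)) km.
have [v Ev v0] := nz x Ux Sx.
have [_] := has_dim_ker (IH (ltnW km)) Ev v0.
by rewrite subnS (EE x Ux Sx).
Qed.

(** A vector of [E k] off the kernel of covector k lies in the kernels of all earlier covectors,
    because these cut out the subbundles containing [E k]. *)
Lemma tower_vectors x : U x -> S x -> exists e : 'I_n.-1 -> CV,
  forall k : 'I_n.-1, (k < m)%N -> [/\ E k x (e k), H10 S x (e k),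
    pairing (dual_covector theta (ls k) x) (e k) != 0 &
    forall j : 'I_n.-1, (j < k)%N -> pairing (dual_covector theta (ls j) x) (e k) = 0].
Proof.
move=> Ux Sx.
suff /choice[e eP] : forall k : 'I_n.-1, exists v, (k < m)%N -> [/\ E k x v, H10 S x v,
    pairing (dual_covector theta (ls k) x) v != 0 &
    forall j : 'I_n.-1, (j < k)%N -> pairing (dual_covector theta (ls j) x) v = 0].
  by exists e.
move=> k; have [km|_] := boolP (k < m)%N; last by exists 0.
have [_ _ _ nz _] := lsP km; have [v Ev v0] := nz x Ux Sx.
exists v => _; split=> //; first exact: tower_sub_H10 (ltnW km) _ Ev.
move=> j jk; have [_ _ _ _ EE] := lsP (ltn_trans jk km).
have : E j.+1 x v by apply: tower_nested Ev => //; rewrite jk ltnW.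
by rewrite EE // => -[].
Qed.

Definition covector_pairs (e : 'I_n.-1 -> CV) x : seq (CV * CV) :=
  [seq (dual_covector theta (ls k) x, e k) | k : 'I_n.-1 <- real_indices].

Lemma exists_triangular x : U x -> S x -> exists e,
  triangular (covector_pairs e x) /\ forall p, p \in covector_pairs e x -> H10 S x p.2.
Proof.
move=> Ux Sx; have [e eP] := tower_vectors Ux Sx.
exists e; split; last first.
  move=> p /mapP[k]; rewrite mem_real_indices => /andP[km _] ->.
  by have [] := eP k km.
apply/andP; split; last first.
  apply/allP => p /mapP[k]; rewrite mem_real_indices => /andP[km _] ->.
  by have [] := eP k km.
rewrite pairwise_map.
apply: (@sub_in_pairwise _ [pred k : 'I_n.-1 | (k < m)%N] (fun j k : 'I_n.-1 => (j < k)%N)).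
- move=> j k _ km jk /=; apply/eqP; by have [_ _ _] := eP k km; apply.
- by apply/allP => k; rewrite mem_real_indices => /andP[].
(* [real_indices] is filtered from an increasing enumeration, so its entries still increase. *)
apply: pairwise_filter.
have := iota_ltn_sorted 0 n.-1; rewrite sorted_pairwise; last exact: ltn_trans.
by rewrite -val_enum_ord pairwise_map.
Qed.

Definition defining_functions (j : 'I_(size real_indices).+1) : V -> R :=
  if unlift ord0 j is Some i then real_form theta (ls (tnth (in_tuple real_indices) i))
  else rho.

Lemma tnth_real_indices (i : 'I_(size real_indices)) :
  tnth (in_tuple real_indices) i \in real_indices.
Proof. exact: mem_tnth. Qed.

Lemma smooth_real_form k : k \in real_indices -> smooth_on U (real_form theta (ls k)).
Proof.
rewrite mem_real_indices => /andP[km s1]; have [_ _ sl _ _] := lsP km.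
case: (ls k) s1 sl => [|L1 [|L2 l]] //= _ /all_sections_cons[s1 /all_sections_cons[s2 sl]].
have sm1 := either_section_smooth Uo s1; have sm2 := either_section_smooth Uo s2.
by have [] := csmooth_fold_lie Uo (smooth_form_bracket eqS ctheta sm2 sm1)
  (all_sections_smooth eqS sl).
Qed.

Lemma smooth_defining_functions j : smooth_on U (defining_functions j).
Proof.
rewrite /defining_functions; case: unliftP => [i _|_]; last by case: eqS.
exact/smooth_real_form/tnth_real_indices.
Qed.

Lemma tower_manifoldP y : U y -> tower_manifold y <-> forall j, defining_functions j y = 0.
Proof.
move=> Uy; have [_ _ _ Sr] := eqS; split=> [[[Sy _] fy] j|H].
  rewrite /defining_functions; case: unliftP => [i _|_]; last exact: (Sr y Uy).1.
  exact/fy/tnth_real_indices.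
split; first by split=> //; apply/(Sr y Uy); have := H ord0; rewrite /defining_functions unlift_none.
move=> k kr; have /tnthP[i ->] : k \in in_tuple real_indices by [].
by have := H (lift ord0 i); rewrite /defining_functions liftK.
Qed.

(** A multiple of [v0], transversal to [S], gives the derivative of [rho] its value. The others are
    then reached by the real part of a vector of [H10 S x]: it is tangent to [S], and its
    derivatives are the real parts of pairings that the triangular system prescribes freely. *)
Lemma defining_functions_surj x : U x -> S x -> forall u : 'I_(size real_indices).+1 -> R,
  exists v : V, forall j, 'D_v (defining_functions j) x = u j.
Proof.
move=> Ux Sx u; have [_ srho dr _] := eqS; have [v0 v0P] := dr x Ux.
have df j : differentiable (defining_functions j) x.
  exact: smooth_differentiable (smooth_defining_functions j) Ux.
have rhoE : defining_functions ord0 = rho by rewrite /defining_functions unlift_none.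
pose a := u ord0 / 'D_v0 rho x.
have [e [tri eH]] := exists_triangular Ux Sx.
(* The contribution of [a *: v0] to the other derivatives is subtracted in advance. *)
pose z i : C := (if insub i is Some i' then u (lift ord0 i') -
    a * 'D_v0 (defining_functions (lift ord0 i')) x else 0)%:C.
have [v vH vz] := triangular_solve z (H10_subspace S x) tri eH.
pose b : V := map_mx (@complex.Re R) v.
exists (a *: v0 + b) => j.
rewrite derive_dirD // derive_dirZ // -Re_cderive //.
have [i ->|->] := unliftP ord0 j; last first.
  rewrite rhoE /a divfK // (gradientE rho) (CT_eq0 eqS) ?addr0 //.
  by case: vH.
have [k kr kE] : exists2 k, k \in real_indices & k = tnth (in_tuple real_indices) i.
  by eexists; [exact: tnth_real_indices|].
have nk : nth k real_indices i = k by rewrite {2}kE (tnth_nth k).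
have fE : defining_functions (lift ord0 i) = real_form theta (ls k).
  by rewrite /defining_functions liftK -kE.
have s1 : (1 < size (ls k))%N by move: kr; rewrite mem_real_indices => /andP[].
have := vz i; rewrite size_map ltn_ord => /(_ isT).
rewrite (nth_map k) //= nk (real_formE _ _ _ s1) /z insubT //= => io.
rewrite (_ : Sub _ _ = i); last exact: val_inj.
by rewrite fE => ->; rewrite /= addrC subrK.
Qed.

Lemma CT_tower_manifold x : tower_manifold x ->
  CT tower_manifold x = [set v | pairing (gradient rho x) v = 0 /\
    forall k, k \in real_indices -> pairing (dual_covector theta (ls k) x) v = 0].
Proof.
move=> Mx; have [[Sx Ux] _] := Mx.
rewrite (CT_zeros Uo Ux smooth_defining_functions tower_manifoldP Mx); last first.
  exact: defining_functions_surj.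
have s1 k : k \in real_indices -> (1 < size (ls k))%N.
  by rewrite mem_real_indices => /andP[].
apply/seteqP; split=> v /=.
  move=> H; split.
    by have := H ord0; rewrite /defining_functions unlift_none gradientE.
  move=> k kr; rewrite real_formE ?s1 //.
  have /tnthP[i kE] : k \in in_tuple real_indices by [].
  by have := H (lift ord0 i); rewrite /defining_functions liftK -kE.
move=> [rho0 H] j; rewrite /defining_functions; case: unliftP => [i _|_].
  by rewrite -real_formE ?H ?s1 // tnth_real_indices.
by rewrite gradientE.
Qed.

Lemma tower_manifold_H10 x : tower_manifold x ->
  has_dim (CT tower_manifold x `&` H10 S x) (n.-1 - size real_indices).
Proof.
move=> Mx; have [[Sx Ux] _] := Mx.
have [e [tri eH]] := exists_triangular Ux Sx.
have := triangular_dim (H10_dim eqS Ux Sx) tri eH; rewrite size_map.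
rewrite CT_tower_manifold //; congr (has_dim _ _).
apply/seteqP; split=> v.
  move=> [vH H]; split=> //; split; first by apply: (CT_eq0 eqS Ux Sx); case: vH.
  by move=> k kr; apply: (H (_, e k)); apply/mapP; exists k.
by move=> [[_ H] vH]; split=> // p /mapP[k kr ->]; exact: H.
Qed.

Lemma tower_manifold_CR : CR_submanifold S tower_manifold.
Proof.
split; first by move=> x [[]].
- exists (size real_indices).+1 => x Mx; have [[Sx Ux] _] := Mx.
  exists U, (fun y => \row_j defining_functions j y); split=> //.
  + by apply: smooth_row => //; exact: smooth_defining_functions.
  + move=> y Uy [[Sy _] _] w.
    have [v vP] := defining_functions_surj Uy Sy (fun j => w ord0 j).
    exists v; rewrite derive_row.
      by apply/rowP => j; rewrite mxE vP.
    by move=> j; exact: (smooth_derivable (smooth_defining_functions j) Uy).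
  apply/seteqP; split=> y.
    move=> [My Uy]; split=> //=; apply/rowP => j.
    by rewrite !mxE; exact: (tower_manifoldP Uy).1.
  move=> [Uy /rowP H]; split=> //; apply/(tower_manifoldP Uy) => j.
  by have := H j; rewrite !mxE.
by exists (n.-1 - size real_indices)%N => x; exact: tower_manifold_H10.
Qed.

(** The dimension of this intersection may vary with [x]; inclusion in the fiber of [E m] bounds it
    uniformly. *)
Lemma tower_manifold_levi x : tower_manifold x -> exists2 d, (d <= n.-1 - m)%N &
  has_dim ((CT tower_manifold x `&` H10 S x) `&` levi_kernel S x) d.
Proof.
move=> Mx; have [[Sx Ux] _] := Mx; have [mn _ _ _ _] := tow.
have [r bH] := tower_H10.
apply: has_dim_sub (tower_dim Ux Sx (leqnn m)) _.
  apply: subspaceI; last exact: (levi_kernel_subspace eqS bH Ux Sx).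
  exact: has_dim_subspace (tower_manifold_H10 Mx).
move=> v [[vT vH] vL].
suff : forall k, (k <= m)%N -> E k x v by apply.
elim=> [_|k IH km]; first by have [_ -> //] := tow.
pose k' := Ordinal (leq_trans km mn).
have [_ s0 sl _ EE] := @lsP k' km.
rewrite (EE x Ux Sx); split; first exact: IH (ltnW km).
have [s1|s1] := ltnP 1 (size (ls k)).
  move: vT; rewrite CT_tower_manifold // => -[_]; apply.
  by rewrite mem_real_indices km.
have : size (ls k') = 1%N by apply/eqP; rewrite eqn_leq s1 s0.
case: (ls k') sl => [|L1 [|]] // /all_sections_cons[sL1 _] _ /=.
apply: (levi_kernel_contraction eqS bH ctheta _ Ux Sx vL).
apply: either_section_weaken sL1 => y Uy Sy.
exact: tower_sub_H10 (ltnW km).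
Qed.

Lemma tower_minimal_manifold x : U x -> S x ->
  (forall sigma, tower_order_at S x sigma -> lex_le tau sigma) -> tower_manifold x.
Proof.
move=> Ux Sx tmin; split=> // k; rewrite mem_real_indices => /andP[km s1].
have [tk _ sl _ _] := lsP km.
apply: contrapT => /eqP nz.
have [_ _ Ek _ _] := tow; have [r bE] := Ek k (ltnW km).
have [EH _] := bE.
have Esub y (Uy : U y) (Sy : S y) := subbundle_subspace bE Uy Sy.
case lsk: (ls k) s1 sl nz tk => [|L1 [|L2 l]] // _ sl nz tk.
have [l0 [v [sz0 sl0 Ev v0]]] := lower_dual eqS ctheta EH Esub sl Ux Sx nz.
have [||sigma /tmin H L] := smaller_tower eqS ctheta tow km tk _ _ sl0 Ux Sx Ev v0.
- by rewrite sz0.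
- by rewrite sz0.
by case: (lex_lt_irrefl (lex_le_lt_trans H L)).
Qed.

End TowerManifold.

(** * The tower multitype *)

Section Multitype.
Context {R : realType} {n : nat}.
Local Notation V := (pt R n).
Implicit Types (S D U : set V) (x p : V) (tau : multi_order n).

(** The point at issue is that a zero of [rho] is a limit of points of [D]. Otherwise rho >= 0 near
    it, so it is a local minimum of [rho], where no derivative could be nonzero. *)
Lemma boundary_local_equation D p : open D -> smooth_boundary D -> boundary D p ->
  exists U rho, U p /\ local_equation (boundary D) U rho.
Proof.
move=> Do sD Dp; have [U [rho [Uo Up srho dr DU]]] := sD p Dp.
exists U, rho; split=> //; split=> // x Ux.
have DI y : U y -> D y <-> rho y < 0.
  move=> Uy; split=> [Dy|ry].
    by have : (D `&` U) y by []; rewrite DU => -[].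
  by have : (U `&` [set x | rho x < 0]) y by []; rewrite -DU => -[].
have crho : {for x, continuous rho} := smooth_continuous srho Ux.
have nU : nbhs x U by exact: open_nbhs_nbhs.
rewrite /boundary ((interior_id D).1 Do).
split=> [[Dx nDx]|rx0].
  apply/eqP; rewrite eq_le; apply/andP; split; last first.
    by rewrite leNgt; apply/negP => /(DI x Ux).
  rewrite leNgt; apply/negP => rx.
  have nr : nbhs x [set y | 0 < rho y] by exact: (cvgr_gt (rho x) crho).
  have [y [Dy [Uy ry]]] := Dx _ (filterI nU nr).
  by have := (DI y Uy).1 Dy; rewrite ltNge (ltW ry).
split; last by move=> /(DI x Ux); rewrite rx0 ltxx.
move=> B nB; apply: contrapT => DB.
have [v /eqP] := dr x Ux; apply.
apply: derive_eq0_at_min; first exact: (smooth_differentiable srho Ux).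
have cl : (r *: v + x) @[r --> (0 : R)] --> x.
  rewrite -[X in _ --> X]add0r -(scale0r v).
  by apply: cvgD; [apply: cvgZr_tmp; exact: cvg_id|exact: cvg_cst].
have nUB : nbhs x (U `&` B) by exact: filterI.
have : \forall r \near (0 : R), (U `&` B) (r *: v + x) by exact: cl nUB.
apply: filterS => r [Uy By]; rewrite rx0 leNgt; apply/negP.
by move=> /(DI _ Uy) Dy; apply: DB; exists (r *: v + x).
Qed.

Lemma num_infinite_ge tau m : (forall k : 'I_n.-1, (m <= k)%N -> tnth tau k = None) ->
  (n.-1 - m <= num_infinite tau)%N.
Proof.
move=> tauN; rewrite /num_infinite -[X in count _ X](map_tnth_enum tau) count_map.
apply: (@leq_trans (count (fun k : 'I_n.-1 => (m <= k)%N) (enum 'I_n.-1))); last first.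
  by apply: sub_count => k /= /tauN ->.
have [mn|nm] := leqP m n.-1; last by rewrite (eqP (_ : (n.-1 - m)%N == 0%N)) // subn_eq0 ltnW.
rewrite -(count_map val) val_enum_ord -[X in iota 0 X](subnKC mn) iotaD count_cat.
rewrite add0n [X in (_ <= _ + X)%N](_ : _ = (n.-1 - m)%N) ?leq_addl //.
apply/eqP; rewrite -[X in _ == X](size_iota m) -all_count.
by apply/allP => k; rewrite mem_iota => /andP[].
Qed.

(** The default value of [xget] has n - 1 >= q infinite entries, so the bound on infinite entries
    already forces the minimum to be attained. *)
Lemma tower_multitype_minimal S p q : (q <= n.-1)%N ->
  (num_infinite (tower_multitype S p) < q)%N ->
  tower_order_at S p (tower_multitype S p) /\
  forall sigma, tower_order_at S p sigma -> lex_le (tower_multitype S p) sigma.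
Proof.
move=> qn; rewrite /tower_multitype; case: xgetP => [tau _ //|_].
have := @num_infinite_ge [tuple None | _ < n.-1] 0 _.
rewrite subn0 => H lt_q.
have : (n.-1 < n.-1)%N.
  by apply: leq_ltn_trans (H _) (leq_trans lt_q qn) => k _; rewrite tnth_mktuple.
by rewrite ltnn.
Qed.

Lemma relatively_open S (P : V -> Prop) :
  (forall p, S p -> P p -> exists U, [/\ open U, U p & forall z, S z -> U z -> P z]) ->
  exists2 O : set V, open O & S `&` [set p | P p] = S `&` O.
Proof.
move=> H; exists (\bigcup_(U in [set U | open U /\ forall z, S z -> U z -> P z]) U).
  by apply: bigcup_open => U [].
apply/seteqP; split=> x [Sx]; last by move=> [U [_ UP] Ux]; split=> //; exact: UP.
by move=> Px; split=> //; have [U [Uo Ux UP]] := H x Sx Px; exists U.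
Qed.

End Multitype.

Theorem proposition1p19 (R : realType) (n : nat) (hn : (2 <= n)%N)
  (D : set (pt R n)) (hD : domain D) (hDb : bounded_set D)
  (hDs : smooth_boundary D)
  (q : nat) (hq1 : (1 <= q)%N) (hqn : (q <= n.-1)%N)
  (hT : forall p, boundary D p ->
    (num_infinite (tower_multitype (boundary D) p) < q)%N) :
  countably_q_regular (boundary D) q /\
  q_regular_decomposition (boundary D) q
    (fun tau : multi_order n =>
       [set p | boundary D p /\ tower_multitype (boundary D) p = tau]).
Proof.
set S := boundary D in hT *; set T := tower_multitype S in hT *.
suff dec : q_regular_decomposition S q (fun tau => [set p | S p /\ T p = tau]).
  by split=> //; eexists; eexists; exact: dec.
have Tmin p (Sp : S p) := tower_multitype_minimal hqn (hT p Sp).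
have Tle p : S p -> exists U, [/\ open U, U p & forall z, S z -> U z -> lex_le (T z) (T p)].
  move=> Sp; have [[U [theta [m [E [Uo Up ct tow]]]]] _] := Tmin p Sp.
  exists U; split=> // z Sz Uz; have [_] := Tmin z Sz; apply.
  by exists U, theta, m, E.
split.
- by apply/seteqP; split=> [p Sp|p [tau _ []] //]; exists (T p).
- by move=> tau sigma _ _ [p [[_ <-] [_ <-]]].
- move=> tau.
  have [p Sp le_p|O Oo SO] := @relatively_open _ _ S (fun p => lex_le (T p) tau).
    have [U [Uo Up UT]] := Tle p Sp; exists U; split=> // z Sz Uz.
    exact: lex_le_trans (UT z Sz Uz) le_p.
  have [p Sp lt_p|O' O'o SO'] := @relatively_open _ _ S (fun p => lex_lt (T p) tau).
    have [U [Uo Up UT]] := Tle p Sp; exists U; split=> // z Sz Uz.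
    exact: lex_le_lt_trans (UT z Sz Uz) lt_p.
  (* The level set is {T <= tau} minus {T < tau}, and both of these sets are relatively open in
     [S]. *)
  exists O, (~` O'); split=> //; first exact: open_closedC.
  rewrite -SO; apply/seteqP; split=> p.
    move=> [Sp Tp]; split; first by split=> //; left.
    move=> O'p; have : (S `&` O') p by [].
    by rewrite -SO' => -[_ /=]; rewrite Tp; exact: lex_lt_irrefl.
  move=> [[Sp /= [Tp|lt_p]] nO'p]; first by [].
  by case: nO'p; have : (S `&` [set p | lex_lt (T p) tau]) p by []; rewrite SO' => -[].
move=> tau p [Sp Tp].
have [[U0 [theta [m [E [U0o U0p ct0 tow0]]]]] _] := Tmin p Sp; rewrite -/T Tp in tow0.
have Do : open D by case: hD.
have [U1 [rho [U1p eqS1]]] := boundary_local_equation Do hDs Sp.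
have U1o : open U1 by case: eqS1.
pose U := U0 `&` U1.
have Uo : open U by exact: openI.
have sU0 : U `<=` U0 by move=> y [].
have sU1 : U `<=` U1 by move=> y [].
have eqS := local_equationS Uo sU1 eqS1.
have ct := sub_contact_form sU0 ct0.
have tow := sub_tower Uo sU0 tow0.
have [ls lsP] := tower_covectors eqS ct tow.
exists (tower_manifold S U theta m ls); split.
- exact: (tower_manifold_CR eqS ct tow lsP).
- exists U; split=> // x [[Sx Tx] Ux].
  apply: (tower_minimal_manifold eqS ct tow lsP Ux Sx).
  by rewrite -Tx; have [] := Tmin x Sx.
move=> x Mx; have [d dm dP] := tower_manifold_levi eqS ct tow lsP Mx.
(* The last n - 1 - m entries of [tau] are infinite, so n - 1 - m is less than [q]. *)
exists d; split=> //; apply: (leq_ltn_trans dm); have := hT p Sp; rewrite Tp.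
apply: leq_ltn_trans; apply: num_infinite_ge.
by have [_ _ _ + _] := tow.
Qed.
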